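(* Fix integers $K,M,N\ge1$ and constants $P_c>0$, $P_{\max}>0$. Let $(\tilde{\mathbf{H}}(n))_{n\ge1}$ be a sequence of block-diagonal matrices $\tilde{\mathbf{H}}(n)=\operatorname{diag}(\tilde{\mathbf{H}}_1(n),\dots,\tilde{\mathbf{H}}_K(n))$, $\tilde{\mathbf{H}}_k(n)\in\mathbb{C}^{N\times M}$, with gradients satisfying $\|\mathbf{V}(n)\|\le V_0$ for all $n$ (notation as in the context). Let $\mathbf{X}(n)$ be generated by the noisy recursion $\mathbf{X}(n+1)=\boldsymbol{\Pi}(\mathbf{X}(n)+\gamma_n\hat{\mathbf{V}}(n))$ from an initial point $\mathbf{X}(1)\in\mathcal{X}$, where $\hat{\mathbf{V}}(n)$ are random Hermitian estimates of $\mathbf{V}(n)$ satisfying: (H1) unbiasedness: $\mathbb{E}[\hat{\mathbf{V}}(n)\mid\mathcal{F}_n]=\mathbf{V}(n)$, where $\mathcal{F}_n$ is the history of the process up to the choice of $\mathbf{X}(n)$; (H2) tame error tails: there exist $B>0$ and $\beta>2$ such that $\mathbb{P}(\|\hat{\mathbf{V}}(n)-\mathbf{V}(n)\|\ge z)\le B/z^\beta$ for all $z>0$ and all $n$. Suppose the step-sizes are $\gamma_n=\gamma/n^\alpha$ with $\gamma>0$ and $\alpha\in(2/\beta,1)$, and let $\mathbf{Q}(n)=\mathbf{Q}(\mathbf{X}(n))$. Then $\mathbf{Q}(n)$ leads to no regret almost surely, i.e. $\limsup_{T\to\infty}T^{-1}\mathrm{Reg}(T)\le0$ a.s., and $$\mathbb{E}[\mathrm{Reg}(T)]\le\frac{1}{\gamma_T}+\frac{\hat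 V_0^2}{2}\sum_{n=1}^T\gamma_n\quad\text{for all }T\ge1,$$ where $\hat V_0^2=\sup_n\mathbb{E}[\|\hat{\mathbf{V}}(n)\|^2]$.
   Context: All matrices are complex; $\mathbf{A}^\dagger$ is the conjugate transpose and $\|\mathbf{A}\|=\operatorname{tr}(\mathbf{A}^\dagger\mathbf{A})^{1/2}$ the Frobenius norm. The effective channel matrices $\tilde{\mathbf{H}}(n)$ are assumed uniformly bounded in $n$. $\mathcal{Q}=\{\mathbf{Q}=\operatorname{diag}(\mathbf{Q}_1,\dots,\mathbf{Q}_K):\mathbf{Q}_k\in\mathbb{C}^{M\times M}\text{ Hermitian},\ \mathbf{Q}_k\succeq0,\ \sum_k\operatorname{tr}\mathbf{Q}_k\le P_{\max}\}$. $\mathrm{EE}(\mathbf{Q};n)=\dfrac{\log\det(\mathbf{I}+\tilde{\mathbf{H}}(n)\mathbf{Q}\tilde{\mathbf{H}}(n)^\dagger)}{P_c+\operatorname{tr}\mathbf{Q}}$, $R_n(\mathbf{Q})=\log\det(\mathbf{I}+\tilde{\mathbf{H}}(n)\mathbf{Q}\tilde{\mathbf{H}}(n)^\dagger)$. $\mathcal{X}=\{\mathbf{X}=\operatorname{diag}(\mathbf{X}_1,\dots,\mathbf{X}_K):\mathbf{X}_k\text{ Hermitian } M\times M,\ \mathbf{X}_k\succeq0,\ \sum_k\operatorname{tr}\mathbf{X}_k\le1\}$, $\mathbf{Q}(\mathbf{X})=\dfrac{P_cP_{\max}}{P_c+P_{\max}(1-\operatorname{tr}\mathbf{X})}\mathbf{X}$,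 $u(\mathbf{X};n)=\mathrm{EE}(\mathbf{Q}(\mathbf{X});n)$. True gradient: $\mathbf{V}(n)=\nabla_{\mathbf{X}}u(\mathbf{X}(n);n)=\dfrac{P_{\max}}{P_c+P_{\max}}\Big[\mathbf{A}_n+\dfrac{\operatorname{tr}(\mathbf{A}_n\mathbf{Q}(n))-R_n(\mathbf{Q}(n))}{P_c}\mathbf{I}\Big]$ with $\mathbf{A}_n=\tilde{\mathbf{H}}(n)^\dagger[\mathbf{I}+\tilde{\mathbf{H}}(n)\mathbf{Q}(n)\tilde{\mathbf{H}}(n)^\dagger]^{-1}\tilde{\mathbf{H}}(n)$. $\boldsymbol{\Pi}(\mathbf{Y})=\arg\min_{\mathbf{X}\in\mathcal{X}}\|\mathbf{X}-\mathbf{Y}\|^2$. $\mathrm{Reg}(T)=\max_{\mathbf{Q}\in\mathcal{Q}}\sum_{n=1}^T[\mathrm{EE}(\mathbf{Q};n)-\mathrm{EE}(\mathbf{Q}(n);n)]$. *)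

(* Defs.v *)
From HB Require Import structures.
From mathcomp Require Import all_boot all_order all_algebra.
From mathcomp Require Import all_classical all_reals all_analysis.
From mathcomp Require Import complex.
Set Implicit Arguments. Unset Strict Implicit. Unset Printing Implicit Defensive.
Import Order.TTheory GRing.Theory Num.Theory.
Import numFieldNormedType.Exports.
Local Open Scope ring_scope.
Local Open Scope classical_set_scope.

Section LinAlg.
Variable R : realType.
Local Notation C := R[i].

Definition ctrmx m n (A : 'M[C]_(m, n)) : 'M[C]_(n, m) := (map_mx Num.conj A)^T.

(* Frobenius norm ||A|| = tr(A^dagger A)^(1/2) (the trace is real >= 0) *)
Definition frob m n (A : 'M[C]_(m, n)) : R :=
  Num.sqrt (complex.Re (\tr (ctrmx A *m A))).

(* real trace (the traces below are of Hermitian matrices, hence real) *)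
Definition trR n (A : 'M[C]_n) : R := complex.Re (\tr A).

Definition is_hermitian n (A : 'M[C]_n) : Prop := ctrmx A = A.

Definition psd n (A : 'M[C]_n) : Prop :=
  is_hermitian A /\ forall v : 'cV[C]_n, 0 <= (ctrmx v *m A *m v) 0 0.

(* Block structure: index k*P + i of 'I_(K*P) is entry i of block k. *)
Definition blockdiag K P Q (A : 'M[C]_(K * P, K * Q)) : Prop :=
  forall (k l : 'I_K) (i : 'I_P) (j : 'I_Q),
    k != l -> A (mxvec_index k i) (mxvec_index l j) = 0.

Definition blk K M (k : 'I_K) (A : 'M[C]_(K * M)) : 'M[C]_M :=
  \matrix_(i, j) A (mxvec_index k i) (mxvec_index k j).

Definition cov_set K M (P : R) : set 'M[C]_(K * M) :=
  [set A | blockdiag A /\ (forall k, psd (blk k A)) /\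
           \sum_(k < K) trR (blk k A) <= P].

Definition Qset K M (Pmax : R) := @cov_set K M Pmax.
Definition Xset K M := @cov_set K M 1.

Definition rate K N M (H : 'M[C]_(K * N, K * M)) (Q : 'M[C]_(K * M)) : R :=
  ln (complex.Re (\det (1%:M + H *m Q *m ctrmx H))).

Definition EE K N M (Pc : R) (H : 'M[C]_(K * N, K * M)) (Q : 'M[C]_(K * M)) : R :=
  rate H Q / (Pc + trR Q).

Definition Qmap n (Pc Pmax : R) (X : 'M[C]_n) : 'M[C]_n :=
  ((Pc * Pmax / (Pc + Pmax * (1 - trR X)))%:C)%C *: X.

Definition Amat K N M (H : 'M[C]_(K * N, K * M)) (Q : 'M[C]_(K * M)) : 'M[C]_(K * M) :=
  ctrmx H *m invmx (1%:M + H *m Q *m ctrmx H) *m H.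

Definition Vgrad K N M (Pc Pmax : R) (H : 'M[C]_(K * N, K * M)) (X : 'M[C]_(K * M))
  : 'M[C]_(K * M) :=
  let Q := Qmap Pc Pmax X in
  ((Pmax / (Pc + Pmax))%:C)%C *:
    (Amat H Q + (((trR (Amat H Q *m Q) - rate H Q) / Pc)%:C)%C%:M).

Definition is_proj n (S : set 'M[C]_n) (Y Z : 'M[C]_n) : Prop :=
  S Z /\ forall W, S W -> frob (Z - Y) <= frob (W - Y).

Definition Reg K N M (Pc Pmax : R) (H : nat -> 'M[C]_(K * N, K * M))
  (Qs : nat -> 'M[C]_(K * M)) (T : nat) : R :=
  sup [set \sum_(1 <= n < T.+1) (EE Pc (H n) Q - EE Pc (H n) (Qs n)) | Q in @Qset K M Pmax].

Definition stepsize (gamma alpha : R) (n : nat) : R := gamma / (n%:R `^ alpha).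

End LinAlg.

Section Prob.
Context (R : realType) (d : measure_display) (T : measurableType d).
Local Notation C := R[i].

Definition Fmeas (G : set (set T)) (g : T -> R) : Prop :=
  forall B : set R, measurable B -> G (g @^-1` B).

Definition mx_Fmeas m n (G : set (set T)) (f : T -> 'M[C]_(m, n)) : Prop :=
  forall i j, Fmeas G (fun w => complex.Re (f w i j)) /\
              Fmeas G (fun w => complex.Im (f w i j)).

Definition is_filtration (F : nat -> set (set T)) : Prop :=
  (forall n, sigma_algebra setT (F n)) /\ (forall n, F n `<=` measurable) /\
  (forall n, F n `<=` F n.+1).

Definition condexp (P : probability T R) (G : set (set T)) (f g : T -> R) : Prop :=
  Fmeas G g /\ P.-integrable setT (EFin \o f) /\ P.-integrable setT (EFin \o g) /\
  forall A, G A -> (\int[P]_(w in A) (f w)%:E = \int[P]_(w in A) (g w)%:E)%E.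

Definition mx_condexp m n (P : probability T R) (G : set (set T))
  (f g : T -> 'M[C]_(m, n)) : Prop :=
  forall i j, condexp P G (fun w => complex.Re (f w i j)) (fun w => complex.Re (g w i j)) /\
              condexp P G (fun w => complex.Im (f w i j)) (fun w => complex.Im (g w i j)).

End Prob.

(* Main.v *)
Require Import Defs.
From HB Require Import structures.
From mathcomp Require Import all_boot all_order all_algebra.
From mathcomp Require Import all_classical all_reals all_analysis.
From mathcomp Require Import complex.
From mathcomp Require Import measurable_realfun.
From mathcomp Require Import ring lra zify.
Set Implicit Arguments. Unset Strict Implicit. Unset Printing Implicit Defensive.
Import Order.TTheory GRing.Theory Num.Theory.
Import numFieldNormedType.Exports.
Local Open Scope ring_scope.
Local Open Scope classical_set_scope.

(** Under the change of variables [X -> Q(X)] the energy efficiency satisfies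
    [EE(Q) - EE(Q(X)) <= <X(Q) - X, V(X)>], a consequence of the tangent
    inequality of the concave function log det.  Since the squared diameter of
    the feasible set is at most 2, telescoping the contraction inequality of the
    projection bounds [sum_n <W - X(n), Vhat(n)>] by
    [1 / gamma_T + sum_n gamma_n |Vhat(n)|^2 / 2].  It remains to replace [Vhat]
    by [V = Vhat - xi].  In expectation [<W - X(n), xi(n)>] vanishes because
    [X(n)] is F_n-measurable.  Almost surely, [<X(n), xi(n)>] and the coordinates
    of [xi(n)] are orthogonal sequences bounded in L^2 (this is where beta > 2
    enters), so their averages tend to 0 by a strong law proved along the
    subsequence of squares; and [sum_n E[gamma_n |xi(n)|^2] / n] converges, so
    the averages of [gamma_n |xi(n)|^2] tend to 0 by Kronecker's lemma. *)

(** * Hermitian and positive semidefinite matrices *)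

Section Hermitian.
Variable R : realType.
Local Notation C := R[i].

(** The regret compares with every feasible Q at once, while the noise enters through
    [<X(Q) - X(n), xi(n)>], which depends on Q. Two devices remove this dependence. Almost surely,
    X(Q) lies in the unit ball, so each of its coordinates is at most 1 in absolute value and its
    pairing with a sum of noises is bounded by finitely many coordinate sums; one null set then
    serves all Q. In expectation, the total efficiency of a fixed Q is deterministic, so a
    comparator within epsilon of the optimum can be chosen before integrating. The iterates are
    given only by the relation [is_proj], with no measurability attached. That X(n) is
    F_n-measurable is derived from the nonexpansiveness of the projection, which makes X(n+1) a
    continuous function of the data preceding the projection. *)

Lemma ctrmxE m n (A : 'M[C]_(m, n)) i j : ctrmx A i j = Num.conj (A j i).
Proof. by rewrite !mxE. Qed.

Lemma ctrmxK m n (A : 'M[C]_(m, n)) : ctrmx (ctrmx A) = A.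
Proof. by apply/matrixP => i j; rewrite !ctrmxE conjCK. Qed.

Lemma ctrmxM m n p (A : 'M[C]_(m, n)) (B : 'M[C]_(n, p)) :
  ctrmx (A *m B) = ctrmx B *m ctrmx A.
Proof. by rewrite /ctrmx map_mxM trmx_mul. Qed.

Lemma ctrmxD m n (A B : 'M[C]_(m, n)) : ctrmx (A + B) = ctrmx A + ctrmx B.
Proof. by rewrite /ctrmx map_mxD linearD. Qed.

Lemma conj_real (x : R) : Num.conj ((x%:C)%C : C) = (x%:C)%C.
Proof. by rewrite conj_Creal // complex_real. Qed.

Lemma ctrmxZ m n (c : R) (A : 'M[C]_(m, n)) :
  ctrmx ((c%:C)%C *: A) = (c%:C)%C *: ctrmx A.
Proof. apply/matrixP => i j; rewrite !mxE rmorphM; congr (_ * _).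
exact: conj_real. Qed.

Lemma ctrmx1 n : ctrmx (1%:M : 'M[C]_n) = 1%:M.
Proof. by rewrite /ctrmx map_mx1 trmx1. Qed.

Lemma ctrmx_diag n (l : 'I_n -> R) :
  ctrmx (diag_mx (\row_i ((l i)%:C)%C)) = diag_mx (\row_i ((l i)%:C)%C).
Proof.
apply/matrixP => i j; rewrite ctrmxE !mxE eq_sym.
by case: (eqVneq i j) => [->|_]; rewrite ?mulr1n ?conj_real // !mulr0n rmorph0.
Qed.

Lemma det_diag_real n (l : 'I_n -> R) :
  \det (diag_mx (\row_i ((l i)%:C)%C)) = ((\prod_i l i)%:C)%C.
Proof. by rewrite det_diag rmorph_prod; apply: eq_bigr => i _; rewrite mxE. Qed.

Lemma tr_diag_real n (l : 'I_n -> R) :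
  \tr (diag_mx (\row_i ((l i)%:C)%C)) = ((\sum_i l i)%:C)%C.
Proof. by rewrite mxtrace_diag rmorph_sum; apply: eq_bigr => i _; rewrite mxE. Qed.

Lemma hermitian_spectral n (A : 'M[C]_n) : is_hermitian A ->
  exists U : 'M[C]_n, exists l : 'I_n -> R,
    [/\ ctrmx U *m U = 1%:M, U *m ctrmx U = 1%:M &
        A = ctrmx U *m diag_mx (\row_i ((l i)%:C)%C) *m U].
Proof.
move=> hA.
have hs : A \is hermsymmx.
  by apply/is_hermitianmxP; rewrite expr0 scale1r -[LHS]hA /ctrmx map_trmx.
have UU := spectral_unitarymx A.
have inv : invmx (spectralmx A) = ctrmx (spectralmx A).
  by rewrite invmx_unitary // /ctrmx map_trmx.
exists (spectralmx A), (fun i => complex.Re (spectral_diag A 0 i)); split.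
- by rewrite -inv mulVmx // unitarymx_unit.
- by rewrite -inv mulmxV // unitarymx_unit.
have /orthomx_spectralP {1}-> := hermitian_normalmx hs; rewrite inv.
congr (_ *m diag_mx _ *m _); apply/rowP => i; rewrite !mxE RRe_real //.
exact: (mxOverP (hermitian_spectral_diag_real hs)).
Qed.

Lemma psd_congr m n (P : 'M[C]_(m, n)) (A : 'M[C]_n) :
  psd A -> psd (P *m A *m ctrmx P).
Proof.
move=> [hA pA]; split; first by rewrite /is_hermitian !ctrmxM ctrmxK hA mulmxA.
by move=> v; move: (pA (ctrmx P *m v)); rewrite ctrmxM ctrmxK !mulmxA.
Qed.

Lemma psd_diag n (A : 'M[C]_n) i : psd A -> 0 <= A i i.
Proof.
move=> [_ /(_ (delta_mx i 0))].
suff -> : (ctrmx (delta_mx i 0 : 'cV[C]_n) *m A *m (delta_mx i 0 : 'cV[C]_n)) 0 0 = A i i by [].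
have -> : ctrmx (delta_mx i 0 : 'cV[C]_n) = delta_mx 0 i.
  by apply/matrixP => j k; rewrite ctrmxE !mxE rmorph_nat andbC.
by rewrite -rowE -colE !mxE.
Qed.

Lemma psd_spectral n (A : 'M[C]_n) : psd A ->
  exists U : 'M[C]_n, exists l : 'I_n -> R,
    [/\ ctrmx U *m U = 1%:M, U *m ctrmx U = 1%:M, forall i, 0 <= l i &
        A = ctrmx U *m diag_mx (\row_i ((l i)%:C)%C) *m U].
Proof.
move=> pA; have [U [l [UU UU' AE]]] := hermitian_spectral pA.1.
exists U, l; split => // i.
have /(psd_diag i) : psd (U *m A *m ctrmx U) by apply: psd_congr.
by rewrite AE !mulmxA UU' mul1mx -mulmxA UU' mulmx1 !mxE eqxx mulr1n lecR.
Qed.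

Lemma tr_spectral n (U : 'M[C]_n) (l : 'I_n -> R) : U *m ctrmx U = 1%:M ->
  \tr (ctrmx U *m diag_mx (\row_i ((l i)%:C)%C) *m U) = ((\sum_i l i)%:C)%C.
Proof. by move=> UU; rewrite mxtrace_mulC mulmxA UU mul1mx tr_diag_real. Qed.

Lemma det_spectral n (U : 'M[C]_n) (l : 'I_n -> R) : U *m ctrmx U = 1%:M ->
  \det (ctrmx U *m diag_mx (\row_i ((l i)%:C)%C) *m U) = ((\prod_i l i)%:C)%C.
Proof.
by move=> UU; rewrite !det_mulmx mulrC mulrA -det_mulmx UU det1 mul1r det_diag_real.
Qed.

Lemma psd0 n : psd (0 : 'M[C]_n).
Proof.
split; first by apply/matrixP => i j; rewrite ctrmxE !mxE rmorph0.
by move=> v; rewrite mulmx0 mul0mx mxE.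
Qed.

Lemma psd1 n : psd (1%:M : 'M[C]_n).
Proof.
split; first exact: ctrmx1.
move=> v; rewrite mulmx1 mxE sumr_ge0 // => i _.
by rewrite ctrmxE mulrC mul_conjC_ge0.
Qed.

Lemma psdD n (A B : 'M[C]_n) : psd A -> psd B -> psd (A + B).
Proof.
move=> [hA pA] [hB pB]; split; first by rewrite /is_hermitian ctrmxD hA hB.
by move=> v; rewrite mulmxDr mulmxDl mxE addr_ge0.
Qed.

Lemma psdZ n (c : R) (A : 'M[C]_n) : 0 <= c -> psd A -> psd ((c%:C)%C *: A).
Proof.
move=> c0 [hA pA]; split; first by rewrite /is_hermitian ctrmxZ hA.
by move=> v; rewrite -scalemxAr -scalemxAl mxE mulr_ge0 // lecR.
Qed.

(** In an eigenbasis [U] of [G], scaling the coordinates by [(1 + l i)^(-1/2)] turns [I + G] into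
    the identity. The determinant is also recorded as a positive real, since [rate] only sees its
    real part. *)
Lemma psd_add1_whiten n (G : 'M[C]_n) : psd G ->
  exists2 P : 'M[C]_n, P *m (1%:M + G) *m ctrmx P = 1%:M &
    0 < complex.Re (\det (1%:M + G)) /\
    \det (1%:M + G) = ((complex.Re (\det (1%:M + G)))%:C)%C.
Proof.
move=> /psd_spectral [U [l [UU UU' l0 GE]]].
have SE : 1%:M + G = ctrmx U *m diag_mx (\row_i ((1 + l i)%:C)%C) *m U.
  have -> : diag_mx (\row_i ((1 + l i)%:C)%C) =
      1%:M + diag_mx (\row_i ((l i)%:C)%C) :> 'M[C]_n.
    by apply/matrixP => i j; rewrite !mxE rmorphD /= mulrnDl.
  by rewrite mulmxDr mulmxDl mulmx1 UU -GE.
have gt0 i : 0 < 1 + l i by rewrite ltr_pwDl.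
exists (diag_mx (\row_i (((Num.sqrt (1 + l i))^-1)%:C)%C) *m U).
  rewrite ctrmxM ctrmx_diag SE !mulmxA.
  rewrite -(mulmxA _ U (ctrmx U)) UU' mulmx1 -(mulmxA _ U (ctrmx U)) UU' mulmx1.
  rewrite !mulmx_diag -[RHS]diag_const_mx; congr diag_mx; apply/rowP => i.
  rewrite !mxE -!rmorphM /= mulrAC -invfM -expr2 sqr_sqrtr ?ltW //.
  by rewrite mulVf // gt_eqF.
rewrite SE det_spectral //=; split => //.
by apply: prodr_gt0 => i _.
Qed.

Lemma prod_le_expR_sum (I : finType) (t : I -> R) : (forall i, 0 <= t i) ->
  \prod_i t i <= expR (\sum_i (t i - 1)).
Proof.
move=> t0; rewrite expR_sum; apply: ler_prod => i _; rewrite t0 /=.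
by have := expR_ge1Dx (t i - 1); rewrite addrC subrK.
Qed.

(** Whitening [S = I + G] by [P] turns [S' = I + G'] into a positive semidefinite matrix with
    eigenvalues [t i]. Their product is [det S' / det S], and the sum of [t i - 1] is
    [tr (S^-1 (S' - S))] because [S^-1 = P^dagger P]. The tangent inequality is then
    [t <= exp (t - 1)], multiplied over the eigenvalues. *)
Lemma logdet_tangent n (G G' : 'M[C]_n) : psd G -> psd G' ->
  ln (complex.Re (\det (1%:M + G'))) <= ln (complex.Re (\det (1%:M + G))) +
    trR (invmx (1%:M + G) *m (G' - G)).
Proof.
move=> pG pG'; have [P PSP [d0 dE]] := psd_add1_whiten pG.
have [_ _ [d0' dE']] := psd_add1_whiten pG'.
set S := 1%:M + G in PSP d0 dE *; set S' := 1%:M + G' in d0' dE' *.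
have Su : S \in unitmx.
  by rewrite unitmxE unitfE dE eq_complex /= eqxx andbT gt_eqF.
have /mulmx1C PPS : P *m (S *m ctrmx P) = 1%:M by rewrite mulmxA.
have invE : invmx S = ctrmx P *m P.
  by apply: (can_inj (mulKmx Su)); rewrite mulmxV // mulmxA PPS.
have dT : \det (P *m S' *m ctrmx P) = \det S' / \det S.
  have dS0 : \det S != 0 by rewrite -unitfE -unitmxE.
  rewrite -[RHS]mulr1 -[X in _ = _ * X](det1 C n) -PSP !det_mulmx.
  by field.
have [U [t [UU UU' t0 TE]]] := psd_spectral (psd_congr P (psdD (psd1 n) pG')).
have prodE : \prod_i t i = complex.Re (\det S') / complex.Re (\det S).
  apply: (@complexI R); rewrite -(det_spectral t UU') -TE dT dE dE' /=.
  by rewrite fmorph_div.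
have sumE : \sum_i (t i - 1) = trR (invmx S *m (G' - G)).
  rewrite /trR; have -> : G' - G = S' - S by rewrite /S /S' opprD addrACA subrr add0r.
  rewrite mulmxBr mulVmx // invE linearB /= -mulmxA mxtrace_mulC TE tr_spectral //.
  rewrite mxtrace1 raddfB /= sumrB; congr (_ - _).
  rewrite sumr_const card_ord.
  by rewrite -(rmorph_nat (real_complex R)).
rewrite addrC -lerBlDr -sumE -ln_div // -prodE.
rewrite -[leRHS]expRK ler_ln ?posrE ?expR_gt0 //; last by rewrite prodE divr_gt0.
exact: prod_le_expR_sum.
Qed.

End Hermitian.

(** * Projected gradient steps *)

Section InnerProduct.
Variable R : realType.
Local Notation C := R[i].

(** The real part makes complex matrices a Euclidean space over [R] whose norm is [frob]. *)
Definition ip m n (A B : 'M[C]_(m, n)) : R := complex.Re (\tr (ctrmx A *m B)).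

Lemma Re_conjM (a b : C) : complex.Re (Num.conj a * b) =
  complex.Re a * complex.Re b + complex.Im a * complex.Im b.
Proof. by case: a b => [a a'] [b b'] /=; rewrite mulNr opprK. Qed.

Lemma Re_sum (I : Type) (r : seq I) (p : pred I) (f : I -> C) :
  complex.Re (\sum_(i <- r | p i) f i) = \sum_(i <- r | p i) complex.Re (f i).
Proof. exact: (raddf_sum (@complex.Re R : Rcomplex R -> R)). Qed.

Lemma Re_rmul (c : R) (z : C) : complex.Re ((c%:C)%C * z) = c * complex.Re z.
Proof. by case: z => a b /=; rewrite mul0r subr0. Qed.

Lemma Im_rmul (c : R) (z : C) : complex.Im ((c%:C)%C * z) = c * complex.Im z.
Proof. by case: z => a b /=; rewrite mul0r addr0. Qed.

Lemma ReD (a b : C) : complex.Re (a + b) = complex.Re a + complex.Re b.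
Proof. by case: a b => [a a'] [b b']. Qed.

Lemma ImD (a b : C) : complex.Im (a + b) = complex.Im a + complex.Im b.
Proof. by case: a b => [a a'] [b b']. Qed.

Lemma ReB (a b : C) : complex.Re (a - b) = complex.Re a - complex.Re b.
Proof. by case: a b => [a a'] [b b']. Qed.

Lemma ImB (a b : C) : complex.Im (a - b) = complex.Im a - complex.Im b.
Proof. by case: a b => [a a'] [b b']. Qed.

Lemma ipE m n (A B : 'M[C]_(m, n)) : ip A B =
  \sum_i \sum_j (complex.Re (A i j) * complex.Re (B i j) +
                 complex.Im (A i j) * complex.Im (B i j)).
Proof.
rewrite /ip /mxtrace Re_sum exchange_big /=; apply: eq_bigr => j _.
by rewrite mxE Re_sum; apply: eq_bigr => i _; rewrite ctrmxE Re_conjM.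
Qed.

Lemma ipC m n (A B : 'M[C]_(m, n)) : ip A B = ip B A.
Proof.
rewrite !ipE; apply: eq_bigr => i _; apply: eq_bigr => j _.
by rewrite mulrC [X in _ + X]mulrC.
Qed.

Lemma ipDr m n (A B D : 'M[C]_(m, n)) : ip A (B + D) = ip A B + ip A D.
Proof. by rewrite /ip mulmxDr mxtraceD ReD. Qed.

Lemma ipZr m n c (A B : 'M[C]_(m, n)) : ip A ((c%:C)%C *: B) = c * ip A B.
Proof. by rewrite /ip -scalemxAr mxtraceZ Re_rmul. Qed.

Lemma ipNr m n (A B : 'M[C]_(m, n)) : ip A (- B) = - ip A B.
Proof. by rewrite -scaleN1r -(rmorphN1 (real_complex R)) ipZr mulN1r. Qed.

Lemma ipDl m n (A B D : 'M[C]_(m, n)) : ip (A + B) D = ip A D + ip B D.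
Proof. by rewrite ipC ipDr !(ipC D). Qed.

Lemma ipZl m n c (A B : 'M[C]_(m, n)) : ip ((c%:C)%C *: A) B = c * ip A B.
Proof. by rewrite ipC ipZr ipC. Qed.

Lemma ipNl m n (A B : 'M[C]_(m, n)) : ip (- A) B = - ip A B.
Proof. by rewrite ipC ipNr ipC. Qed.

Definition ip_lin := (ipDl, ipDr, ipNl, ipNr, ipZl, ipZr).

Lemma ip_ge0 m n (A : 'M[C]_(m, n)) : 0 <= ip A A.
Proof.
rewrite ipE; apply: sumr_ge0 => i _; apply: sumr_ge0 => j _.
by rewrite -!expr2 addr_ge0 // sqr_ge0.
Qed.

Lemma frobE m n (A : 'M[C]_(m, n)) : frob A = Num.sqrt (ip A A).
Proof. by []. Qed.

Lemma sqr_frob m n (A : 'M[C]_(m, n)) : frob A ^+ 2 = ip A A.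
Proof. by rewrite frobE sqr_sqrtr // ip_ge0. Qed.

Lemma frob_le m n (A B : 'M[C]_(m, n)) :
  (frob A <= frob B) = (ip A A <= ip B B).
Proof. by rewrite !frobE ler_psqrt // ?qualifE /= ip_ge0. Qed.

Lemma ip_amgm m n (A B : 'M[C]_(m, n)) : 2 * ip A B <= ip A A + ip B B.
Proof.
by have := ip_ge0 (A - B); rewrite !ip_lin (ipC B A); lra.
Qed.

Lemma trR_ip n (A B : 'M[C]_n) : is_hermitian A -> ip A B = trR (A *m B).
Proof. by rewrite /ip => ->. Qed.

Lemma trRD n (A B : 'M[C]_n) : trR (A + B) = trR A + trR B.
Proof. by rewrite /trR mxtraceD ReD. Qed.

Lemma trRB n (A B : 'M[C]_n) : trR (A - B) = trR A - trR B.
Proof. by rewrite /trR linearB /= ReB. Qed.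

Lemma trRZ n c (A : 'M[C]_n) : trR ((c%:C)%C *: A) = c * trR A.
Proof. by rewrite /trR mxtraceZ Re_rmul. Qed.

Lemma trR_psd n (A : 'M[C]_n) : psd A -> 0 <= trR A.
Proof.
move=> pA; rewrite /trR /mxtrace Re_sum; apply: sumr_ge0 => i _.
by have := psd_diag i pA; rewrite lecE => /andP[].
Qed.

Lemma ip_psd n (A B : 'M[C]_n) : psd A -> psd B -> 0 <= ip A B.
Proof.
move=> pA pB; rewrite (trR_ip _ pA.1).
have [U [l [UU UU' l0 ->]]] := psd_spectral pA.
rewrite /trR -mulmxA -mulmxA mxtrace_mulC -mulmxA -mulmxA.
rewrite (mulmxA U) /mxtrace Re_sum; apply: sumr_ge0 => i _.
rewrite mul_diag_mx !mxE Re_rmul mulr_ge0 //.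
have := psd_diag i (psd_congr U pB).
by rewrite mxE lecE => /andP[].
Qed.

(** Nonnegative eigenvalues satisfy [sum l_i^2 <= (sum l_i)^2]. The trace constraint thereby places
    [Xset] in the Frobenius unit ball. *)
Lemma ip_psd_le n (A : 'M[C]_n) : psd A -> ip A A <= trR A ^+ 2.
Proof.
move=> pA; rewrite (trR_ip _ pA.1).
have [U [l [UU UU' l0 AE]]] := psd_spectral pA.
have -> : A *m A = ctrmx U *m diag_mx (\row_i ((l i * l i)%:C)%C) *m U.
  rewrite {1 2}AE !mulmxA -(mulmxA _ U (ctrmx U)) UU' mulmx1.
  rewrite -(mulmxA (ctrmx U)) mulmx_diag; congr (_ *m diag_mx _ *m _).
  by apply/rowP => i; rewrite !mxE -rmorphM.
rewrite {}/trR {1}AE !tr_spectral //=.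
rewrite expr2 mulr_suml ler_sum // => i _.
apply: ler_wpM2l => //.
by rewrite (bigD1 i) //= lerDl sumr_ge0.
Qed.

End InnerProduct.

(** * The feasible set and its metric projection *)

Section CovSet.
Variable R : realType.
Local Notation C := R[i].
Variables (K M : nat).

Lemma sum_mxvec (V : nmodType) (N1 N2 : nat) (f : 'I_(N1 * N2) -> V) :
  \sum_p f p = \sum_(k < N1) \sum_(i < N2) f (mxvec_index k i).
Proof.
rewrite (reindex _ (curry_mxvec_bij N1 N2)) /= pair_bigA /=.
by apply: eq_bigr => -[].
Qed.

Lemma blkD (k : 'I_K) (A B : 'M[C]_(K * M)) : blk k (A + B) = blk k A + blk k B.
Proof. by apply/matrixP => i j; rewrite !mxE. Qed.

Lemma blkZ (k : 'I_K) c (A : 'M[C]_(K * M)) : blk k (c *: A) = c *: blk k A.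
Proof. by apply/matrixP => i j; rewrite !mxE. Qed.

Lemma cov_set_tr p (A : 'M[C]_(K * M)) : cov_set p A -> trR A <= p.
Proof.
move=> [_ [_]]; apply: le_trans.
rewrite /trR /mxtrace Re_sum sum_mxvec ler_sum // => k _.
by rewrite Re_sum ler_sum // => i _; rewrite mxE.
Qed.

Lemma cov_set_psd p (A : 'M[C]_(K * M)) : cov_set p A -> psd A.
Proof.
move=> [bA [pA _]]; split.
  apply/matrixP => a b; rewrite ctrmxE.
  case/mxvec_indexP: a => k i; case/mxvec_indexP: b => l j.
  have [->|kl] := eqVneq k l; last by rewrite bA 1?eq_sym // bA // rmorph0.
  by have /matrixP/(_ i j) := (pA l).1; rewrite ctrmxE !mxE.
move=> v.
have -> : (ctrmx v *m A *m v) 0 0 = \sum_(k < K)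
    (ctrmx (\col_i v (mxvec_index k i) 0) *m blk k A *m
       (\col_i v (mxvec_index k i) 0)) 0 0.
  rewrite mxE sum_mxvec; apply: eq_bigr => l _.
  rewrite mxE; apply: eq_bigr => j _; rewrite [_ j 0]mxE; congr (_ * _).
  rewrite !mxE sum_mxvec (bigD1 l) //= [X in _ + X]big1 ?addr0.
    by apply: eq_bigr => i _; rewrite !ctrmxE !mxE.
  by move=> k kl; rewrite big1 // => i _; rewrite bA // mulr0.
by apply: sumr_ge0 => k _; apply: (pA k).2.
Qed.

Lemma cov_setZ p q c (A : 'M[C]_(K * M)) : 0 <= c -> c * trR A <= q ->
  cov_set p A -> cov_set q ((c%:C)%C *: A).
Proof.
move=> c0 cq [bA [pA tA]]; split=> [k l i j kl|]; first by rewrite mxE bA // mulr0.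
split=> [k|]; first by rewrite blkZ; exact: psdZ.
under eq_bigr do rewrite blkZ trRZ.
rewrite -mulr_sumr; apply: le_trans cq; rewrite ler_wpM2l //.
rewrite /trR /mxtrace Re_sum sum_mxvec ler_sum // => k _.
by rewrite Re_sum ler_sum // => i _; rewrite mxE.
Qed.

Lemma cov_setD p q (A B : 'M[C]_(K * M)) :
  cov_set p A -> cov_set q B -> cov_set (p + q) (A + B).
Proof.
move=> [bA [pA tA]] [bB [pB tB]]; split=> [k l i j kl|].
  by rewrite mxE bA // bB // addr0.
split=> [k|]; first by rewrite blkD; exact: psdD.
under eq_bigr do rewrite blkD trRD.
by rewrite big_split lerD.
Qed.

Lemma cov_set_convex p (A B : 'M[C]_(K * M)) (t : R) : 0 <= t <= 1 ->
  cov_set p A -> cov_set p B -> cov_set p (A + (t%:C)%C *: (B - A)).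
Proof.
move=> /andP[t0 t1] cA cB.
have -> : A + (t%:C)%C *: (B - A) = ((1 - t)%:C)%C *: A + (t%:C)%C *: B.
  by rewrite scalerBr rmorphB /= scalerBl scale1r addrCA addrC addrAC.
have -> : p = (1 - t) * p + t * p by ring.
apply: cov_setD.
  by apply: (cov_setZ _ _ cA); rewrite ?ler_wpM2l ?subr_ge0 ?(cov_set_tr cA).
by apply: (cov_setZ _ _ cB); rewrite ?ler_wpM2l ?(cov_set_tr cB).
Qed.

Lemma cov_set0 p : 0 <= p -> cov_set p (0 : 'M[C]_(K * M)).
Proof.
move=> p0; split=> [k l i j kl|]; first by rewrite mxE.
have b0 (k : 'I_K) : blk k (0 : 'M[C]_(K * M)) = 0.
  by apply/matrixP => i j; rewrite !mxE.
split=> [k|]; first by rewrite b0; exact: psd0.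
by rewrite big1 // => k _; rewrite b0 /trR mxtrace0.
Qed.

Lemma Xset_ip (X : 'M[C]_(K * M)) : Xset X -> ip X X <= 1.
Proof.
move=> XX; have pX := cov_set_psd XX; apply: le_trans (ip_psd_le pX) _.
by rewrite exprn_ile1 ?trR_psd // (cov_set_tr XX).
Qed.

(** The cross term [-2 <X, Y>] is nonpositive for positive semidefinite matrices, so the bound is 1
    + 1 instead of the 4 given by the triangle inequality. This yields the coefficient 1 of
    [1 / gamma_T]. *)
Lemma Xset_dist (X Y : 'M[C]_(K * M)) : Xset X -> Xset Y ->
  ip (X - Y) (X - Y) <= 2.
Proof.
move=> XX XY; have := Xset_ip XX; have := Xset_ip XY.
have := ip_psd (cov_set_psd XX) (cov_set_psd XY).
by rewrite !ip_lin (ipC Y X); lra.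
Qed.

(** Moving from [Z] towards [W] by a fraction [t] stays feasible, so minimality gives
    [2 <W - Z, Y - Z> <= t |W - Z|^2] for every [t] in (0, 1]. *)
Lemma proj_variational p (Y Z W : 'M[C]_(K * M)) :
  is_proj (cov_set p) Y Z -> cov_set p W -> ip (W - Z) (Y - Z) <= 0.
Proof.
move=> [SZ minZ] SW.
have h t : 0 < t <= 1 -> 2 * ip (W - Z) (Y - Z) <= t * ip (W - Z) (W - Z).
  move=> /andP[t0 t1]; have t01 : 0 <= t <= 1 by rewrite ltW.
  have := minZ _ (cov_set_convex t01 SZ SW); rewrite frob_le.
  move: (W - Z) => D.
  have -> : Z + (t%:C)%C *: D - Y = (t%:C)%C *: D - (Y - Z).
    by rewrite opprB addrCA addrA.
  rewrite -[Z - Y]opprB; move: (Y - Z) => E.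
  rewrite !ip_lin (ipC E D) => hh.
  have : 0 <= t * (t * ip D D - 2 * ip D E) by lra.
  by rewrite pmulr_rge0 //; lra.
rewrite leNgt; apply/negP => gt0.
set a := ip (W - Z) (Y - Z) in h gt0; set b := ip (W - Z) (W - Z) in h.
have b0 : 0 <= b by exact: ip_ge0.
(* In place of a limit [t -> 0]: the case [t = 1] gives [a / b <= 1 / 2], so [t = a / b] is
   admissible and yields [2 a <= a], against [a > 0]. *)
have := h 1; rewrite ltr01 lexx => /(_ isT); rewrite mul1r => hb.
have b_gt0 : 0 < b by lra.
have := h (a / b); rewrite divfK ?gt_eqF // divr_gt0 // ler_pdivrMr // mul1r.
by lra.
Qed.

Lemma proj_contract p (Y Z W : 'M[C]_(K * M)) :
  is_proj (cov_set p) Y Z -> cov_set p W ->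
  ip (W - Z) (W - Z) <= ip (W - Y) (W - Y).
Proof.
move=> pZ SW; have := proj_variational pZ SW.
have -> : W - Y = (W - Z) - (Y - Z) by rewrite opprB addrA subrK.
move: (W - Z) (Y - Z) => D E; have := ip_ge0 E.
by rewrite !ip_lin (ipC E D); lra.
Qed.

(** The two variational inequalities add up to [|Z - Z'|^2 <= <Z - Z', Y - Y'>], and [ip_amgm]
    concludes. *)
Lemma proj_nonexpansive p (Y Z Y' Z' : 'M[C]_(K * M)) :
  is_proj (cov_set p) Y Z -> is_proj (cov_set p) Y' Z' ->
  ip (Z - Z') (Z - Z') <= ip (Y - Y') (Y - Y').
Proof.
move=> pZ pZ'; have := proj_variational pZ pZ'.1.
have := proj_variational pZ' pZ.1; have := ip_amgm (Z - Z') (Y - Y').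
rewrite -[Z' - Z]opprB.
have -> : Y' - Z' = (Y - Z) + (Z - Z') - (Y - Y').
  by rewrite addrA subrK opprB [RHS]addrC addrA subrK.
by move: (Y - Y') (Y - Z) (Z - Z') => E F D; rewrite !ip_lin; lra.
Qed.

End CovSet.

(** * Change of variables and tangent inequality for the energy efficiency *)

Section Gradient.
Variable R : realType.
Local Notation C := R[i].
Variables (K N M : nat) (Pc Pmax : R).
Hypotheses (Pc0 : 0 < Pc) (Pmax0 : 0 < Pmax).
Implicit Types (H : 'M[C]_(K * N, K * M)) (Q X : 'M[C]_(K * M)).

(* Inverse of the change of variables [Qmap]. *)
Definition Xmap Q : 'M[C]_(K * M) :=
  (((Pc + Pmax) / (Pmax * (Pc + trR Q)))%:C)%C *: Q.

Lemma Xmap_Xset Q : Qset Pmax Q -> Xset (Xmap Q).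
Proof.
move=> QQ; have t0 := trR_psd (cov_set_psd QQ); have t1 := cov_set_tr QQ.
apply: cov_setZ QQ; first by rewrite divr_ge0 ?mulr_ge0 ?addr_ge0 // ltW.
rewrite mulrAC ler_pdivrMr ?mulr_gt0 ?ltr_pwDl // mul1r.
rewrite mulrDl mulrDr [Pmax * Pc]mulrC lerD2r ler_pM2l //.
Qed.

Lemma rate_tangent H Q Q' : psd Q -> psd Q' ->
  rate H Q' <= rate H Q + trR (Amat H Q *m (Q' - Q)).
Proof.
move=> pQ pQ'; have := logdet_tangent (psd_congr H pQ) (psd_congr H pQ').
rewrite /rate; congr (_ <= _ + _); rewrite /trR /Amat -mulmxBl -mulmxBr.
by rewrite !mulmxA mxtrace_mulC !mulmxA.
Qed.

(** In the variable X the factor [s = 1 / (Pc + tr Q)] is affine and [Q = k X / s] with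
    [k = Pmax / (Pc + Pmax)]. The efficiency is thus [s R(k X / s)], a perspective of the concave
    rate, and lies below its tangents. *)
Lemma EE_tangent H Q X : Qset Pmax Q -> Xset X ->
  EE Pc H Q - EE Pc H (Qmap Pc Pmax X) <= ip (Xmap Q - X) (Vgrad Pc Pmax H X).
Proof.
move=> QQ XX; have t0 := trR_psd (cov_set_psd QQ).
have x0 := trR_psd (cov_set_psd XX); have x1 := cov_set_tr XX.
have d0 : 0 < Pc + Pmax * (1 - trR X) by rewrite ltr_pwDl // mulr_ge0 ?subr_ge0 // ltW.
rewrite /EE /Vgrad; set Q0 := Qmap Pc Pmax X.
have pQ0 : psd Q0.
  by apply: psdZ (cov_set_psd XX); rewrite divr_ge0 ?mulr_ge0 // ltW.
have := rate_tangent H pQ0 (cov_set_psd QQ).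
move: (rate H Q) (rate H Q0) (Amat H Q0) => R1 R0 A.
rewrite mulmxBr trRB /Q0 /Qmap -scalemxAr !trRZ.
have hX : is_hermitian (Xmap Q - X).
  have [hQ _] := psdZ (ltW Pc0) (cov_set_psd QQ).
  by rewrite /is_hermitian -scaleN1r -(rmorphN1 (real_complex R)) ctrmxD !ctrmxZ
    (cov_set_psd QQ).1 (cov_set_psd XX).1.
rewrite ipZr ipDr !(trR_ip _ hX) mul_mx_scalar trRZ !mulmxBl !trRB /Xmap.
rewrite -scalemxAl !trRZ.
rewrite [trR (Q *m A)]/trR mxtrace_mulC -/(trR (A *m Q)).
rewrite [trR (X *m A)]/trR mxtrace_mulC -/(trR (A *m X)).
move: (trR (A *m Q)) (trR (A *m X)) (trR Q) (trR X) t0 x0 x1 d0 => r1 xA t x.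
move=> t0 x0 x1 d0 hR.
have s0 : 0 < Pc + t by rewrite ltr_pwDl.
have e0 : 0 < Pc + Pmax by rewrite addr_gt0.
set c := Pc * Pmax / (Pc + Pmax * (1 - x)).
have cx0 : 0 < Pc + c * x.
  by rewrite ltr_pwDl // mulr_ge0 // divr_ge0 ?mulr_ge0 // ltW.
apply: (@le_trans _ _ ((R0 + r1 - c * xA) / (Pc + t) - R0 / (Pc + c * x))).
  by rewrite lerD2r ler_pM2r ?invr_gt0 // -addrA.
(* Here equality holds: linearising the rate was the only loss. *)
rewrite le_eqVlt; apply/orP; left; apply/eqP.
have cxE : Pc + c * x = Pc * (Pc + Pmax) / (Pc + Pmax * (1 - x)).
  by rewrite /c; field; lra.
rewrite cxE /c; field; rewrite ?gt_eqF //.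
Qed.

End Gradient.

(** * Pathwise regret of a projected recursion *)

Section MirrorDescent.
Variable R : realType.
Local Notation C := R[i].
Variables (K M : nat) (g : nat -> R) (x v : nat -> 'M[C]_(K * M)).
Hypothesis g_gt0 : forall n, (0 < n)%N -> 0 < g n.
Hypothesis g_dec : forall n, (0 < n)%N -> g n.+1 <= g n.
Hypothesis x1 : Xset (x 1%N).
Hypothesis xS : forall n, (0 < n)%N ->
  is_proj (@Xset R K M) (x n + ((g n)%:C)%C *: v n) (x n.+1).

Lemma iterates_Xset n : (0 < n)%N -> Xset (x n).
Proof. by case: n => [//|[//|n] _]; case: (xS (ltn0Sn n)). Qed.

Lemma one_step W n : Xset W -> (0 < n)%N ->
  ip (W - x n) (v n) <= (ip (W - x n) (W - x n) -
    ip (W - x n.+1) (W - x n.+1)) / (2 * g n) + g n / 2 * ip (v n) (v n).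
Proof.
move=> XW n0; have := proj_contract (xS n0) XW; have gn := g_gt0 n0.
have -> : W - (x n + ((g n)%:C)%C *: v n) = (W - x n) - ((g n)%:C)%C *: v n.
  by rewrite opprD addrA.
move: (W - x n) (W - x n.+1) (v n) => D D' V.
rewrite !ip_lin (ipC V D) => h.
have -> : (ip D D - ip D' D') / (2 * g n) + g n / 2 * ip V V =
  (ip D D - ip D' D' + g n ^+ 2 * ip V V) / (2 * g n) by field; rewrite gt_eqF.
by rewrite ler_pdivlMr ?mulr_gt0 //; lra.
Qed.

(** Nothing probabilistic enters: the bound holds for arbitrary directions [v n], hence for every
    outcome of the noise. *)
Lemma regret_bound W T : Xset W -> (0 < T)%N ->
  \sum_(1 <= n < T.+1) ip (W - x n) (v n) <=
    (g T)^-1 + \sum_(1 <= n < T.+1) g n / 2 * ip (v n) (v n).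
Proof.
move=> XW T0.
(* The induction retains the last distance. With [a], [b] consecutive step-sizes and [D] the current
   squared distance, the slack of one step is [(1/b - 1/a) (1 - D/2)], nonnegative since the steps
   decrease and [D <= 2]. *)
suff : \sum_(1 <= n < T.+1) ip (W - x n) (v n) <=
    (g T)^-1 - ip (W - x T.+1) (W - x T.+1) / (2 * g T) +
    \sum_(1 <= n < T.+1) g n / 2 * ip (v n) (v n).
  move=> /le_trans; apply; rewrite lerD2r gerBl divr_ge0 ?ip_ge0 //.
  by rewrite mulr_ge0 // ltW // g_gt0.
elim: T T0 => [//|[|T] IH] _.
  have gn := g_gt0 (ltn0Sn 0).
  rewrite !big_nat1; apply: le_trans (one_step XW _) _ => //.
  rewrite lerD2r mulrBl lerD2r ler_pdivrMr ?mulr_gt0 // mulrCA mulVf ?gt_eqF //.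
  by rewrite mulr1; exact: Xset_dist (iterates_Xset _).
rewrite big_nat_recr //= [in leRHS]big_nat_recr //=.
have := one_step XW (ltn0Sn T.+1); have := IH isT.
have := g_gt0 (ltn0Sn T); have := g_gt0 (ltn0Sn T.+1); have := g_dec (ltn0Sn T).
have := Xset_dist XW (iterates_Xset (ltn0Sn T.+1)).
set s := \sum_(1 <= n < T.+2) _ * _; set D := ip (W - x T.+2) _.
set D' := ip (W - x T.+3) _; set a := g T.+1; set b := g T.+2.
move=> D2 ba b0 a0 h1 h2.
have h3 : 0 <= (b^-1 - a^-1) * (1 - D / 2).
  by rewrite mulr_ge0 // subr_ge0 ?lef_pV2 ?posrE // ler_pdivrMr // mul1r.
apply: le_trans (lerD h1 h2) _.
rewrite [_ / (2 * b)]mulrBl !invfM; lra.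
Qed.

End MirrorDescent.

(** * Sub-sigma-algebras and square-integrable functions *)

Section SubSigma.
Context (R : realType) (d : measure_display) (T : measurableType d).
Implicit Types (G : set (set T)) (f g : T -> R).

(** Translates [Fmeas] into ordinary measurability over the generated sigma-algebra, so that the
    usual closure properties become available. *)
Lemma Fmeas_measurable G g : sigma_algebra setT G ->
  Fmeas G g <-> measurable_fun setT (g : g_sigma_algebraType G -> R).
Proof.
move=> sG; have GE := sigma_algebra_id sG; split => [h _ B mB|h B mB].
  by rewrite setTI; apply: sub_sigma_algebra; exact: h.
by have := h measurableT B mB; rewrite setTI; rewrite -[X in _ -> X _]GE.
Qed.

Lemma Fmeas_le G G' g : G `<=` G' -> Fmeas G g -> Fmeas G' g.
Proof. by move=> GG h B mB; apply: GG; exact: h. Qed.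

Lemma Fmeas_measurable_fun G g : G `<=` measurable -> Fmeas G g ->
  measurable_fun setT g.
Proof. by move=> GG h _ B mB; rewrite setTI; apply: GG; exact: h. Qed.

Lemma FmeasD G f g : sigma_algebra setT G ->
  Fmeas G f -> Fmeas G g -> Fmeas G (f \+ g).
Proof.
move=> sG /(Fmeas_measurable _ sG) mf /(Fmeas_measurable _ sG) mg.
by apply/(Fmeas_measurable _ sG); exact: measurable_funD.
Qed.

Lemma FmeasM G f g : sigma_algebra setT G ->
  Fmeas G f -> Fmeas G g -> Fmeas G (f \* g).
Proof.
move=> sG /(Fmeas_measurable _ sG) mf /(Fmeas_measurable _ sG) mg.
by apply/(Fmeas_measurable _ sG); exact: measurable_funM.
Qed.

Lemma Fmeas_cst G c : sigma_algebra setT G -> Fmeas G (cst c : T -> R).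
Proof. by move=> sG; apply/(Fmeas_measurable _ sG); exact: measurable_cst. Qed.

Lemma FmeasB G f g : sigma_algebra setT G ->
  Fmeas G f -> Fmeas G g -> Fmeas G (f \- g).
Proof.
move=> sG /(Fmeas_measurable _ sG) mf /(Fmeas_measurable _ sG) mg.
by apply/(Fmeas_measurable _ sG); exact: measurable_funB.
Qed.

Lemma Fmeas_sum G (I : Type) (s : seq I) (h : I -> T -> R) :
  sigma_algebra setT G -> (forall i, Fmeas G (h i)) ->
  Fmeas G (fun x => \sum_(i <- s) h i x).
Proof.
move=> sG hm; apply/(Fmeas_measurable _ sG).
by apply: measurable_sum => i; apply/(Fmeas_measurable _ sG).
Qed.

End SubSigma.

(** * Square-integrable functions and conditionally centred noise *)

Section Integrals.
Context (R : realType) (d : measure_display) (T : measurableType d).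
Variable P : probability T R.
Implicit Types (f g : T -> R).
Import HBNNSimple.
Local Open Scope ereal_scope.

(* Spares a proof that the regret, a supremum over an uncountable family, is
   measurable. *)
Lemma le_integral_pointwise (f g : T -> \bar R) : (forall x, f x <= g x) ->
  \int[P]_x f x <= \int[P]_x g x.
Proof.
move=> fg.
have mono (u v : T -> \bar R) : (forall x, 0 <= u x) -> (forall x, u x <= v x) ->
    \int[P]_x u x <= \int[P]_x v x.
  move=> u0 uv; have v0 x : 0 <= v x by exact: le_trans (uv x).
  rewrite !ge0_integralTE //; apply: le_ereal_sup => _ [h /= hu <-].
  by exists h => // x; exact: le_trans (uv x).
rewrite integralE [leRHS]integralE leeB // mono // => x.
- by apply: (@funepos_le _ _ setT f g) => [y _|]; rewrite ?inE.
- by apply: (@funeneg_le _ _ setT f g) => [y _|]; rewrite ?inE.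
Qed.

Lemma integral_cst_prob (r : R) : \int[P]_x r%:E = r%:E.
Proof.
by rewrite integral_cst // -[RHS]mule1; congr (_ * _); exact: probability_setT.
Qed.

Definition L2 f := measurable_fun setT f /\
  P.-integrable setT (fun x => (f x ^+ 2)%:E).

Lemma L2_le f g : measurable_fun setT f -> (forall x, (f x ^+ 2 <= g x ^+ 2)%R) ->
  L2 g -> L2 f.
Proof.
move=> mf fg [mg ig]; split => //.
apply: le_integrable ig => //.
  by apply/measurable_EFinP; exact: measurable_funX.
by move=> x _; rewrite !gee0_abs ?lee_fin ?sqr_ge0.
Qed.

Lemma L2_integrableM f g : L2 f -> L2 g ->
  P.-integrable setT (fun x => (f x * g x)%:E).
Proof.
move=> [mf if2] [mg ig2].
apply: le_integrable (integrableD measurableT if2 ig2) => //.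
  by apply/measurable_EFinP; exact: measurable_funM.
move=> x _ /=; rewrite lee_fin [leRHS]ger0_norm ?addr_ge0 ?sqr_ge0 // normrM.
rewrite -(real_normK (num_real (f x))) -(real_normK (num_real (g x))).
have := sqr_ge0 (`|f x| - `|g x|)%R; have := normr_ge0 (f x); have := normr_ge0 (g x).
by move: `|f x|%R `|g x|%R => a b; nra.
Qed.

Lemma L2D f g : L2 f -> L2 g -> L2 (f \+ g)%R.
Proof.
move=> Lf Lg; split; first exact: measurable_funD Lf.1 Lg.1.
have -> : (fun x => ((f \+ g)%R x ^+ 2)%:E) = (fun x => (f x ^+ 2)%:E) \+
   ((fun x => (f x * g x)%:E) \+ ((fun x => (f x * g x)%:E) \+ (fun x => (g x ^+ 2)%:E))).
  by apply/funext => x /=; rewrite -!EFinD; congr EFin; ring.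
apply: integrableD => //; first exact: Lf.2.
apply: integrableD => //; first exact: L2_integrableM.
by apply: integrableD => //; [exact: L2_integrableM | exact: Lg.2].
Qed.

Lemma L2Z c f : L2 f -> L2 (fun x => c * f x)%R.
Proof.
move=> Lf; split; first by apply: measurable_funM => //; exact: Lf.1.
under eq_fun do rewrite exprMn EFinM.
by apply: integrableZl => //; exact: Lf.2.
Qed.

Lemma L2_cst c : L2 (cst c).
Proof.
split; first exact: measurable_cst.
exact: (finite_measure_integrable_cst P (c ^+ 2) measurableT).
Qed.

Lemma L2_sum (I : Type) (s : seq I) (h : I -> T -> R) : (forall i, L2 (h i)) ->
  L2 (fun x => \sum_(i <- s) h i x)%R.
Proof.
move=> Lh; elim: s => [|i s IH].
  by under eq_fun do rewrite big_nil; exact: L2_cst.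
by under eq_fun do rewrite big_cons; exact: L2D.
Qed.

Lemma L2_integrable f : L2 f -> P.-integrable setT (EFin \o f).
Proof.
move=> Lf; have := L2_integrableM Lf (L2_cst 1%R).
by under eq_fun do rewrite mulr1.
Qed.

Lemma L2M_bounded c f g : measurable_fun setT g -> (forall x, `|g x| <= c)%R ->
  L2 f -> L2 (f \* g)%R.
Proof.
move=> mg gc Lf; apply: L2_le (L2Z c Lf); first exact: measurable_funM Lf.1 mg.
move=> x; rewrite !exprMn mulrC ler_wpM2r ?sqr_ge0 //.
rewrite -(real_normK (num_real (g x))) ler_pXn2r ?nnegrE //.
exact: le_trans (gc x).
Qed.

(** Vanishing integrals over the sets of [G] say that [f] has zero conditional expectation given
    [G]. This passes to simple [G]-measurable factors by linearity and to [g] by dominated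
    convergence. *)
Lemma pull_out (G : set (set T)) f g : sigma_algebra setT G -> G `<=` measurable ->
  P.-integrable setT (EFin \o f) ->
  (forall A, G A -> \int[P]_(x in A) (f x)%:E = 0) ->
  Fmeas G g -> P.-integrable setT (fun x => (g x * f x)%:E) ->
  \int[P]_x (g x * f x)%:E = 0.
Proof.
move=> sG Gm fi f0.
(* The positive and negative parts of [g] are dominated by [|g|], so their products with [f] remain
   integrable and the two integrals may be subtracted. *)
wlog g0 : g / forall x, (0 <= g x)%R.
  move=> IH gG gfi.
  have mg : measurable_fun setT g by exact: Fmeas_measurable_fun gG.
  have mf : measurable_fun setT f by apply/measurable_EFinP; exact: measurable_int fi.
  have part (h : T -> R) : (forall x, `|h x| <= `|g x|)%R -> (forall x, 0 <= h x)%R ->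
      Fmeas G h -> P.-integrable setT (fun x => (h x * f x)%:E) /\
      \int[P]_x (h x * f x)%:E = 0.
    move=> hg h0 hG.
    have hi : P.-integrable setT (fun x => (h x * f x)%:E).
      apply: le_integrable gfi => //.
        apply/measurable_EFinP; apply: measurable_funM => //.
        exact: Fmeas_measurable_fun hG.
      by move=> x _ /=; rewrite lee_fin !normrM ler_wpM2r.
    by split => //; exact: IH.
  have sGT := (Fmeas_measurable g sG).1 gG.
  have [] := part (g^\+)%R.
  - move=> x; rewrite /funrpos /Order.max; case: ifP => // _; by rewrite normr0.
  - by move=> x; exact: funrpos_ge0.
  - by apply/(Fmeas_measurable _ sG); exact: measurable_funrpos.
  move=> ip i0; have [] := part (g^\-)%R.
  - move=> x; rewrite /funrneg /Order.max; case: ifP => // _; by rewrite ?normr0 ?normrN.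
  - by move=> x; exact: funrneg_ge0.
  - by apply/(Fmeas_measurable _ sG); exact: measurable_funrneg.
  move=> im j0.
  transitivity (\int[P]_x ((fun x => ((g^\+)%R x * f x)%:E) \- (fun x => ((g^\-)%R x * f x)%:E)) x).
    apply: eq_integral => x _ /=; rewrite -EFinB -mulrBl; congr (_ * _)%:E.
    by rewrite -[in LHS](funrposBneg g).
  by rewrite integralB // i0 j0 subee.
move=> gG gfi.
have mg : measurable_fun setT (g : g_sigma_algebraType G -> R).
  exact/(Fmeas_measurable g sG).
(* The approximants are built over the sigma-algebra generated by [G], so that their level sets
   belong to [G], where [f] integrates to 0. *)
pose a := nnsfun_approx measurableT ((measurable_EFinP _ _).2 mg).
have mf : measurable_fun setT f by apply/measurable_EFinP; exact: measurable_int fi.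
have aG n : Fmeas G (a n : T -> R).
  by apply/(Fmeas_measurable _ sG); exact: measurable_funPT.
have ma n : measurable_fun setT (a n : T -> R).
  exact: Fmeas_measurable_fun (aG n).
have a0 n : \int[P]_x (a n x * f x)%:E = 0.
  have rG r : G (a n @^-1` [set r]) by apply: aG.
  have ii r : P.-integrable setT (fun x => (r * (\1_(a n @^-1` [set r]) x * f x))%:E).
    under eq_fun do rewrite EFinM; apply: integrableZl => //.
    apply: le_integrable fi => //.
      apply/measurable_EFinP; apply: measurable_funM => //.
      by apply: measurable_indic; exact: Gm.
    move=> x _ /=; rewrite lee_fin normrM ler_piMl // indicE.
    by case: (_ \in _); rewrite ?normr1 ?normr0.
  transitivity (\int[P]_x \sum_(r <- finmap.enum_fset (fset_set (range (a n))))
      (r * (\1_(a n @^-1` [set r]) x * f x))%:E).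
    apply: eq_integral => x _; rewrite {1}(fimfunE (a n)) fsbig_finite //=.
    by rewrite mulr_suml sumEFin; congr EFin; apply: eq_bigr => r _; rewrite mulrA.
  rewrite integral_sum // big1 // => r _.
  under eq_integral do rewrite EFinM.
  rewrite integralZl //; last first.
    apply: le_integrable fi => //.
      apply/measurable_EFinP; apply: measurable_funM => //.
      by apply: measurable_indic; exact: Gm.
    move=> x _ /=; rewrite lee_fin normrM ler_piMl // indicE.
    by case: (_ \in _); rewrite ?normr1 ?normr0.
  rewrite (_ : \int[P]_x _ = 0) ?mule0 //.
  rewrite -[RHS](f0 _ (rG r)) [RHS]integral_mkcond; apply: eq_integral => x _.
  rewrite patchE indicE; case: ifP => _; by rewrite ?mul1r ?mul0r.
have cv : (fun n => \int[P]_x (a n x * f x)%:E) @ \oo --> \int[P]_x (g x * f x)%:E.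
  have [|||||_ _ cv] := @dominated_convergence _ _ _ P setT measurableT
    (fun n x => (a n x * f x)%:E) (fun x => (g x * f x)%:E) (fun x => `|(g x * f x)%:E|).
  - by move=> n; apply/measurable_EFinP; exact: measurable_funM.
  - by apply: measurable_int gfi.
  - apply: aeW => x _ /=; under eq_fun do rewrite EFinM; rewrite EFinM.
    apply: cvgeM; [|apply: cvg_nnsfun_approx => // y _; by rewrite lee_fin | exact: cvg_cst].
    exact: mule_def_fin.
  - exact: integrable_abse gfi.
  - apply: aeW => x n _ /=; rewrite lee_fin !normrM ler_wpM2r //.
    rewrite !ger0_norm // -lee_fin /a nnsfun_approxE.
    by apply: le_approx => // y _; rewrite lee_fin.
  - exact: cv.
apply/esym; have := cvg_lim (@ereal_hausdorff R) cv; move=> <-.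
under eq_fun do rewrite a0; exact/esym/lim_cst.
Qed.

End Integrals.

(** * Laws of large numbers *)

Section Sequences.
Context (R : realType).
Implicit Types (a : nat -> R).

Lemma sum_inv_sqr_le n : \sum_(k < n) ((k.+1%:R : R) ^+ 2)^-1 <= 2.
Proof.
(* The correction [2 / (n + 1)] makes the bound exact at [n = 0]; its decrease [2 / (m (m + 1))] at
   [m = n + 1] dominates [1 / m^2] as soon as [m >= 1]. *)
suff : \sum_(k < n) ((k.+1%:R : R) ^+ 2)^-1 <= 2 - 2 / n.+1%:R.
  by move/le_trans; apply; rewrite gerBl divr_ge0.
elim: n => [|n IH]; first by rewrite big_ord0 divr1 subrr.
rewrite big_ord_recr /=; apply: le_trans (lerD IH (lexx _)) _.
rewrite -addrA lerD2l -subr_ge0.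
have n0 : 0 < n.+1%:R :> R by [].
rewrite -[n.+2]addn1 natrD; move: (n.+1%:R : R) (ler1n R n.+1) n0 => m m1 m0.
have -> : - (2 / (m + 1)) - (- (2 / m) + (m ^+ 2)^-1) = (m - 1) / (m ^+ 2 * (m + 1)).
  by field; rewrite !gt_eqF // addr_gt0.
by rewrite divr_ge0 // ?subr_ge0 // mulr_ge0 ?sqr_ge0 // addr_ge0 // ltW.
Qed.

Lemma sqr_sum_le (m n : nat) a :
  (\sum_(m <= i < n) a i) ^+ 2 <= (n - m)%:R * \sum_(m <= i < n) a i ^+ 2.
Proof.
rewrite expr2 big_distrlr /=.
apply: (@le_trans _ _ (\sum_(m <= i < n) \sum_(m <= j < n) (a i ^+ 2 / 2 + a j ^+ 2 / 2))).
  apply: ler_sum => i _; apply: ler_sum => j _.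
  by have := sqr_ge0 (a i - a j); lra.
rewrite (eq_bigr (fun i => (a i ^+ 2 / 2) *+ (n - m) + \sum_(m <= j < n) a j ^+ 2 / 2)).
  by rewrite big_split /= sumr_const_nat sumrMnl -mulr_suml -mulrnDl -splitr mulr_natl.
by move=> i _; rewrite big_split /= sumr_const_nat.
Qed.

Lemma square_window n : exists k, (k ^ 2 <= n < k.+1 ^ 2)%N.
Proof.
elim: n => [|n [k /andP[kn nk]]]; first by exists 0%N.
have [h|h] := ltnP n.+1 (k.+1 ^ 2); first by exists k; rewrite h (leqW kn).
by exists k.+1; rewrite h (leq_ltn_trans nk) // ltn_exp2r.
Qed.

(** For [(k+1)^2 <= n < (k+2)^2] the partial sum up to [n] differs from the one up to [(k+1)^2] by
    at most the absolute sum over the window. The hypotheses are squared because they are met as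
    general terms of convergent series of squares. *)
Lemma average_cvg_squares a :
  (fun k => ((\sum_(0 <= i < k.+1 ^ 2) a i) / (k.+1 ^ 2)%:R) ^+ 2) @ \oo --> (0 : R) ->
  (fun k => ((\sum_(k.+1 ^ 2 <= i < k.+2 ^ 2) `|a i|) / (k.+1 ^ 2)%:R) ^+ 2) @ \oo
     --> (0 : R) ->
  (fun n => (\sum_(0 <= i < n) a i) / n%:R) @ \oo --> (0 : R).
Proof.
move=> /cvgr0Pnorm_lt h1 /cvgr0Pnorm_lt h2; apply/cvgr0Pnorm_lt => e e0.
have e2 : 0 < (e / 2) ^+ 2 by rewrite exprn_gt0 // divr_gt0.
have [K1 _ {}h1] := h1 _ e2; have [K2 _ {}h2] := h2 _ e2.
exists ((maxn K1 K2).+1 ^ 2)%N => // n /= Kn.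
have [[//|k] /andP[kn nk]] := square_window n.
  by move: nk Kn; rewrite exp1n ltnS leqn0 => /eqP ->; rewrite leqn0 expn_eq0.
have Kk : (maxn K1 K2 <= k)%N.
  by have := leq_ltn_trans Kn nk; rewrite ltn_exp2r // ltnS.
have small x : `|x ^+ 2| < (e / 2) ^+ 2 -> `|x| < e / 2.
  by rewrite normrX ltr_pXn2r ?nnegrE // divr_ge0 // ltW.
have /small := h1 k (leq_trans (leq_maxl _ _) Kk).
have /small := h2 k (leq_trans (leq_maxr _ _) Kk).
have m0 : 0 < (k.+1 ^ 2)%:R :> R by rewrite ltr0n expn_gt0.
rewrite !normrM !normfV !(ger0_norm (ltW m0)) ger0_norm ?sumr_ge0 //.
rewrite (@big_cat_nat _ _ _ (k.+1 ^ 2)%N 0 n) //= ltr_pdivrMr // ltr_pdivrMr //.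
move=> {}h2 {}h1; have n0 : 0 < n%:R :> R by apply: lt_le_trans m0 _; rewrite ler_nat.
rewrite (ger0_norm (ltW n0)) ltr_pdivrMr //.
apply: le_lt_trans (ler_normD _ _) _.
have h3 : `|\sum_(k.+1 ^ 2 <= i < n) a i| <= \sum_(k.+1 ^ 2 <= i < k.+2 ^ 2) `|a i|.
  apply: le_trans (ler_norm_sum _ _ _) _.
  by rewrite [leRHS](@big_cat_nat _ _ _ n) ?lerDl ?sumr_ge0 // ltnW.
have : e * (k.+1 ^ 2)%:R <= e * n%:R by rewrite ler_wpM2l ?ler_nat // ltW.
by move: h1 h2 h3; lra.
Qed.

(** Summation by parts writes the average as a partial sum [s] of the series minus a Cesaro mean of
    [s]; both have the same limit. *)
Lemma kronecker a : cvgn (series (fun k => a k / k.+1%:R)) ->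
  (fun n => (\sum_(0 <= i < n) a i) / n%:R) @ \oo --> (0 : R).
Proof.
set s := series _ => cs.
have E n : \sum_(0 <= i < n) a i = n%:R * s n - series s n.
  elim: n => [|n IH]; first by rewrite /s /series /= !big_nil mul0r subrr.
  rewrite big_nat_recr //= IH -[n.+1]addn1 natrD /= addn1 !seriesSr /=.
  have -> : s n.+1 = s n + a n / (n%:R + 1) by rewrite /s seriesSr natr1.
  field.
  by rewrite natr1 pnatr_eq0.
rewrite -cvg_shiftS /=.
have -> : (fun n => (\sum_(0 <= i < n.+1) a i) / n.+1%:R) =
    (fun n => s n.+1 - arithmetic_mean s n).
  apply/funext => n; rewrite E /arithmetic_mean /= mulrBl mulrAC mulfV ?pnatr_eq0 //.
  by rewrite mul1r [in RHS]mulrC.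
suff : (fun n => s n.+1 - arithmetic_mean s n) @ \oo --> limn s - limn s by rewrite subrr.
apply: cvgB; last exact: cesaro.
by rewrite (cvg_shiftS s).
Qed.

(** Telescoping form of the integral test for [sum n^(-1 - al)]. It rests on
    [(1 + 1/n)^al >= 1 + al ln (1 + 1/n)] and [ln (1 + 1/n) = - ln (1 - 1/(n+1)) >= 1/(n+1)]. *)
Lemma powR_inv_step (al : R) (n : nat) : 0 < al -> (0 < n)%N ->
  (n.+1%:R `^ al)^-1 / n.+1%:R <= al^-1 * ((n%:R `^ al)^-1 - (n.+1%:R `^ al)^-1).
Proof.
move=> al0 n0; have n0' : 0 < n%:R :> R by rewrite ltr0n.
have m0' : 0 < n.+1%:R :> R by rewrite ltr0n.
set u := n%:R `^ al; set v := n.+1%:R `^ al.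
have u0 : 0 < u by exact: powR_gt0.
have v0 : 0 < v by exact: powR_gt0.
suff h : u * (1 + al / n.+1%:R) <= v.
  rewrite -(ler_pM2l al0) [leRHS]mulrA mulfV ?gt_eqF // mul1r.
  rewrite -(ler_pM2l u0) -(ler_pM2l v0).
  have -> : v * (u * (al * (v^-1 / n.+1%:R))) = u * (1 + al / n.+1%:R) - u.
    by field; rewrite !gt_eqF.
  have -> : v * (u * (u^-1 - v^-1)) = v - u by field; rewrite !gt_eqF.
  by rewrite lerD2r.
have vE : v = u * expR (al * ln (n.+1%:R / n%:R)).
  rewrite /u /v /powR !gt_eqF // -expRD ln_div // mulrBr addrC.
  by rewrite subrK.
rewrite vE ler_pM2l //; apply: le_trans (expR_ge1Dx _); rewrite lerD2l.
rewrite ler_pM2l // -[n.+1%:R / _]invrK lnV ?posrE ?invr_gt0 ?divr_gt0 // invf_div.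
have -> : n%:R / n.+1%:R = 1 + - (n.+1%:R)^-1 :> R.
  by rewrite -natr1; field; rewrite natr1 gt_eqF.
rewrite lerNr; apply: le_ln1Dx.
by rewrite ltrN2 invf_lt1 // ltr1n ltnS.
Qed.

Lemma sum_stepsize_le (al : R) n : 0 < al ->
  \sum_(0 <= k < n) stepsize 1 al k.+1 / k.+1%:R <= 1 + al^-1.
Proof.
move=> al0; case: n => [|n]; first by rewrite big_nil addr_ge0 // invr_ge0 ltW.
suff : \sum_(0 <= k < n.+1) stepsize 1 al k.+1 / k.+1%:R <=
    1 + al^-1 * (1 - (n.+1%:R `^ al)^-1).
  by move=> /le_trans; apply; rewrite lerD2l ger_pMr ?invr_gt0.
elim: n => [|n IH].
  by rewrite big_nat1 /stepsize !powR1 invr1 subrr mulr0 addr0 !mulr1.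
rewrite big_nat_recr //=; apply: le_trans (lerD IH (lexx _)) _.
rewrite -addrA lerD2l {1}/stepsize div1r.
apply: le_trans (lerD (lexx _) (powR_inv_step al0 (ltn0Sn n))) _.
by rewrite -mulrDr addrA subrK.
Qed.

Lemma cvgn_series_stepsize (g al : R) : 0 < g -> 0 < al ->
  cvgn (series (fun k => stepsize g al k.+1 / k.+1%:R)).
Proof.
move=> g0 al0.
have st0 c n : 0 <= c -> 0 <= stepsize c al n :> R.
  by move=> c0; rewrite /stepsize divr_ge0 // powR_ge0.
apply: nondecreasing_is_cvgn.
  by apply: nondecreasing_series => n _ _; rewrite divr_ge0 // st0 // ltW.
exists (g * (1 + al^-1)) => _ [n _ <-].
apply: le_trans (ler_wpM2l (ltW g0) (sum_stepsize_le n al0)).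
by rewrite /series /= mulr_sumr; apply: ler_sum => i _; rewrite /stepsize div1r !mulrA.
Qed.

(** Up to [1/g], the left side is [n^(al - 1)], the mean of [n] equal terms, each at most
    [i^(al - 1)] for [i <= n]. The decay of [1 / (n gamma_n)] thus also follows from [kronecker],
    applied with the exponent [1 - al]. *)
Lemma inv_stepsize_le (g al : R) n : 0 < g -> al < 1 -> (0 < n)%N ->
  (stepsize g al n)^-1 / n%:R <=
  g^-1 * ((\sum_(0 <= i < n) stepsize 1 (1 - al) i.+1) / n%:R).
Proof.
move=> g0 al1 n0; have n0' : 0 < n%:R :> R by rewrite ltr0n.
rewrite /stepsize invf_div.
have -> : n%:R `^ al / g / n%:R = g^-1 * (n%:R `^ al / n%:R) by ring.
rewrite ler_pM2l ?invr_gt0 // ler_pM2r ?invr_gt0 //.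
have b0 : 0 < n%:R `^ (1 - al) :> R by rewrite powR_gt0.
have -> : n%:R `^ al = (n%:R `^ (1 - al))^-1 *+ (n - 0) :> R.
  rewrite subn0 -[RHS]mulr_natl; apply: (mulIf (lt0r_neq0 b0)) => /=; rewrite divfK ?gt_eqF //.
  rewrite -powRD; last by rewrite (gt_eqF n0') implybT.
  by rewrite addrC subrK powRr1.
rewrite -sumr_const_nat !big_nat; apply: ler_sum => i /andP[_ ni]; rewrite div1r.
rewrite lef_pV2 ?posrE ?powR_gt0 //.
by apply: ge0_ler_powR; rewrite ?nnegrE ?ler_nat // subr_ge0 ltW.
Qed.

Lemma cvg_inv_stepsize (g al : R) : 0 < g -> al < 1 ->
  (fun n => (stepsize g al n)^-1 / n%:R) @ \oo --> (0 : R).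
Proof.
move=> g0 al1; have b0 : 0 < 1 - al by rewrite subr_gt0.
have h := kronecker (cvgn_series_stepsize (ltr01 : 0 < 1 :> R) b0).
have h' : (fun n => g^-1 * ((\sum_(0 <= i < n) stepsize 1 (1 - al) i.+1) / n%:R)) @ \oo
    --> g^-1 * (0 : R) by apply: cvgM => //; exact: cvg_cst.
rewrite mulr0 in h'.
apply: (squeeze_cvgr _ (cvg_cst 0) h'); near=> n.
have n0 : (0 < n)%N by near: n; exact: nbhs_infty_gt.
rewrite divr_ge0 ?invr_ge0 ?divr_ge0 ?powR_ge0 ?(ltW g0) //=.
exact: inv_stepsize_le.
Unshelve. all: by end_near. Qed.

End Sequences.

(** * Almost sure convergence from second moments *)

Section AlmostSure.
Context (R : realType) (d : measure_display) (T : measurableType d).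
Variable P : probability T R.
Local Open Scope ereal_scope.

(** By monotone convergence the sum of the nonnegative [Y k] has expectation at most [C], hence is
    finite almost everywhere. *)
Lemma ae_cvgn_series (Y : nat -> T -> R) (c : nat -> R) (C : R) :
  (forall k, measurable_fun setT (Y k)) -> (forall k x, 0 <= Y k x)%R ->
  (forall k, \int[P]_x (Y k x)%:E <= (c k)%:E) ->
  (forall n, \sum_(0 <= k < n) c k <= C)%R ->
  {ae P, forall x, cvgn (series (fun k => Y k x))}.
Proof.
move=> mY Y0 Yc cC.
pose S x := \sum_(k <oo) (Y k x)%:E.
have iS : P.-integrable setT S.
  apply/integrableP; split.
    by apply: ge0_emeasurable_sum => k *; [rewrite lee_fin | exact/measurable_EFinP].
  rewrite (eq_integral S); last first.
    by move=> x _; rewrite gee0_abs //; apply: nneseries_ge0 => k _ _; rewrite lee_fin.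
  rewrite integral_nneseries //; last 2 first.
    by move=> k; exact/measurable_EFinP.
    by move=> k x _; rewrite lee_fin.
  apply: (@le_lt_trans _ _ C%:E); last exact: ltry.
  apply: lime_le.
    by apply: is_cvg_nneseries => k _ _; apply: integral_ge0 => x _; rewrite lee_fin.
  apply: nearW => n; apply: (@le_trans _ _ (\sum_(0 <= k < n) (c k)%:E)).
    by apply: lee_sum => k _.
  by rewrite sumEFin lee_fin.
apply: filterS (integrable_ae measurableT iS) => x /(_ I) Sx.
apply: nondecreasing_is_cvgn; first exact: nondecreasing_series.
exists (fine (S x)) => _ [n _ <-].
rewrite -lee_fin fineK // /series /= -sumEFin.
by apply: nneseries_lim_ge => k _ _; rewrite lee_fin.
Qed.

Lemma integral_sqr_sum (e : nat -> T -> R) (C : R) : (forall i, L2 P (e i)) ->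
  (forall i, \int[P]_x (e i x ^+ 2)%:E <= C%:E) ->
  (forall i j, (i < j)%N -> \int[P]_x (e i x * e j x)%:E = 0) ->
  forall n, \int[P]_x ((\sum_(0 <= i < n) e i x) ^+ 2)%:E <= (n%:R * C)%:E.
Proof.
move=> Le eC e0; elim=> [|n IH].
  by under eq_integral do rewrite big_nil expr0n; rewrite integral0 mul0r.
have Ls : L2 P (fun x => \sum_(0 <= i < n) e i x)%R by exact: L2_sum.
have is0 : P.-integrable setT (fun x => ((\sum_(0 <= i < n) e i x) * e n x)%:E).
  exact: L2_integrableM.
have s0 : \int[P]_x ((\sum_(0 <= i < n) e i x) * e n x)%:E = 0.
  under eq_integral do rewrite mulr_suml -sumEFin.
  rewrite integral_sum //; last by move=> i; exact: L2_integrableM.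
  by rewrite big_nat big1 // => i /andP[_ ni]; exact: e0.
have -> : \int[P]_x ((\sum_(0 <= i < n.+1) e i x) ^+ 2)%:E =
    \int[P]_x ((\sum_(0 <= i < n) e i x) ^+ 2)%:E + \int[P]_x (e n x ^+ 2)%:E.
  transitivity (\int[P]_x ((((\sum_(0 <= i < n) e i x) ^+ 2)%:E +
    (2%:E * ((\sum_(0 <= i < n) e i x) * e n x)%:E)) + (e n x ^+ 2)%:E)).
    apply: eq_integral => x _; rewrite big_nat_recr //= -EFinM -!EFinD; congr EFin.
    by ring.
  have i2 := integrableZl measurableT 2 is0.
  rewrite integralD //; [|exact: integrableD Ls.2 i2 | exact: (Le n).2].
  rewrite integralD //; last exact: Ls.2.
  by rewrite integralZl // s0 mule0 adde0.
by rewrite -natr1 mulrDl mul1r EFinD leeD.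
Qed.

Lemma slln_orthogonal (e : nat -> T -> R) (C : R) : (forall i, L2 P (e i)) ->
  (forall i, \int[P]_x (e i x ^+ 2)%:E <= C%:E) ->
  (forall i j, (i < j)%N -> \int[P]_x (e i x * e j x)%:E = 0) ->
  {ae P, forall x,
     (fun n => ((\sum_(0 <= i < n) e i x) / n%:R)%R) @ \oo --> (0%R : R)}.
Proof.
move=> Le eC e0.
have C0 : (0 <= C)%R.
  rewrite -lee_fin; apply: le_trans (eC 0%N).
  by apply: integral_ge0 => x _; rewrite lee_fin sqr_ge0.
have me i : measurable_fun setT (e i) by exact: (Le i).1.
have sumc (c : R) : (0 <= c)%R ->
    forall n, (\sum_(0 <= k < n) c * ((k.+1%:R : R) ^+ 2)^-1 <= c * 2)%R.
  by move=> c0 n; rewrite -mulr_sumr ler_wpM2l // big_mkord sum_inv_sqr_le.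
have scale (f : T -> R) (m : nat) (c : R) : measurable_fun setT f ->
   \int[P]_x (f x ^+ 2)%:E <= c%:E ->
   \int[P]_x ((f x / m%:R) ^+ 2)%:E <= (c / (m%:R ^+ 2))%:E.
  move=> mf fc; under eq_integral do rewrite exprMn exprVn mulrC EFinM.
  rewrite ge0_integralZl_EFin //.
  - by rewrite [(c / _)%R]mulrC EFinM lee_wpmul2l // lee_fin invr_ge0 sqr_ge0.
  - by move=> x _; rewrite lee_fin sqr_ge0.
  - by apply/measurable_EFinP; exact: measurable_funX.
have h1 : {ae P, forall x, cvgn (series (fun k =>
    (((\sum_(0 <= i < k.+1 ^ 2) e i x) / (k.+1 ^ 2)%:R) ^+ 2)%R))}.
  apply: (ae_cvgn_series _ _ _ (sumc C C0)) => [k|k x|k]; last 2 first.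
  - exact: sqr_ge0.
  - apply: le_trans (scale _ _ _ _ (integral_sqr_sum Le eC e0 _)) _.
      exact: measurable_sum.
    rewrite lee_fin natrX [(_ * C)%R]mulrC -mulrA ler_wpM2l // expr2 invfM mulrA.
    by rewrite mulfV ?mul1r // expf_neq0 // pnatr_eq0.
  by apply: measurable_funX; apply: measurable_funM => //; exact: measurable_sum.
have h2 : {ae P, forall x, cvgn (series (fun k =>
    (((\sum_(k.+1 ^ 2 <= i < k.+2 ^ 2) `|e i x|) / (k.+1 ^ 2)%:R) ^+ 2)%R))}.
  (* The 9 comes from the window length [2 k + 3 <= 3 (k + 1)], squared. *)
  have C9 : (0 <= 9 * C)%R by rewrite mulr_ge0.
  have mabs i : measurable_fun setT (fun x => `|e i x|)%R.
    by apply: measurableT_comp => //; exact: me.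
  apply: (ae_cvgn_series _ _ _ (sumc _ C9)) => [k|k x|k]; last 2 first.
  - exact: sqr_ge0.
  - have kE : ((k.+2 ^ 2 - k.+1 ^ 2) = 2 * k + 3)%N.
      by apply/eqP; rewrite -(eqn_add2r (k.+1 ^ 2)) subnK ?leq_exp2r //; apply/eqP; nia.
    have ie : \int[P]_x ((\sum_(k.+1 ^ 2 <= i < k.+2 ^ 2) `|e i x|) ^+ 2)%:E <=
        ((2 * k + 3)%:R ^+ 2 * C)%:E.
      apply: (@le_trans _ _ (\int[P]_x ((2 * k + 3)%:R%:E *
          \sum_(k.+1 ^ 2 <= i < k.+2 ^ 2) (e i x ^+ 2)%:E))).
        apply: le_integral_pointwise => x; rewrite sumEFin -EFinM lee_fin.
        apply: le_trans (sqr_sum_le _ _ _) _; rewrite kE ler_wpM2l // le_eqVlt.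
        by apply/orP; left; apply/eqP; apply: eq_bigr => i _; rewrite real_normK ?num_real.
      rewrite ge0_integralZl_EFin //; last 2 first.
      - by move=> x _; rewrite sumEFin lee_fin sumr_ge0 // => i _; exact: sqr_ge0.
      - apply: emeasurable_sum => i; apply/measurable_EFinP; exact: measurable_funX.
      rewrite integral_sum //; last by move=> i; exact: (Le i).2.
      rewrite expr2 -mulrA EFinM lee_wpmul2l ?lee_fin //.
      apply: (@le_trans _ _ (\sum_(k.+1 ^ 2 <= i < k.+2 ^ 2) C%:E)).
        by apply: lee_sum => i _.
      by rewrite sumEFin sumr_const_nat kE mulr_natl.
    apply: le_trans (scale _ _ _ _ ie) _; first exact: measurable_sum.
    rewrite lee_fin natrX; have k0 : (0 < k.+1%:R :> R)%R by [].
    rewrite ler_pdivrMr ?exprn_gt0 //.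
    have -> : (9 * C / k.+1%:R ^+ 2 * (k.+1%:R ^+ 2) ^+ 2 = (3 * k.+1%:R) ^+ 2 * C :> R)%R.
      by field; rewrite gt_eqF.
    by rewrite ler_wpM2r // ler_pXn2r ?nnegrE ?mulr_ge0 // -natrM ler_nat; lia.
  by apply: measurable_funX; apply: measurable_funM => //; exact: measurable_sum.
apply: filterS2 h1 h2 => x /cvg_series_cvg_0 c1 /cvg_series_cvg_0 c2.
exact: average_cvg_squares.
Qed.

(** [C] precedes [h], so the bound is uniform over the noises. The layer at [2^k] contributes at
    most [4^(k+1) B 2^(-k beta) = 4 B q^k], and [q = 4 / 2^beta] is below 1 exactly because
    [beta > 2]. *)
Lemma tail_second_moment (B beta : R) : (0 < B)%R -> (2 < beta)%R ->
  exists C : R, forall h : T -> R, measurable_fun setT h -> (forall x, 0 <= h x)%R ->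
    (forall z, (0 < z)%R -> P [set x | (z <= h x)%R] <= (B / z `^ beta)%:E) ->
    \int[P]_x (h x ^+ 2)%:E <= C%:E.
Proof.
move=> B0 b2; pose q : R := (4 / 2 `^ beta)%R.
have p0 : (0 < (2 : R) `^ beta)%R by rewrite powR_gt0.
have q0 : (0 < q)%R by rewrite divr_gt0.
have q1 : (q < 1)%R.
  rewrite ltr_pdivrMr // mul1r; have -> : (4 = 2 `^ 2 :> R)%R.
    by rewrite powR_mulrn //; ring.
  by rewrite /powR !pnatr_eq0 /= ltr_expR ltr_pM2r // ln_gt0 // ltr1n.
exists (1 + 4 * B * (1 - q)^-1)%R => h mh h0 hP.
pose A k := [set x | (2 ^+ k <= h x)%R].
have mA k : measurable (A k).
  by rewrite -[A k]setTI; apply: measurable_fun_le => //; exact: measurable_cst.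
pose Y k x : R := (4 ^+ k.+1 * \1_(A k) x)%R.
have Y0 k x : (0 <= Y k x)%R by rewrite mulr_ge0 // exprn_ge0.
have mY k : measurable_fun setT (Y k).
  by apply: measurable_funM => //; exact: measurable_indic.
(* Dyadic layers: [h ^ 2 <= 1 + sum_k 4 ^ (k + 1) 1_(2 ^ k <= h)]. *)
apply: (@le_trans _ _ (\int[P]_x (1 + \sum_(k <oo) (Y k x)%:E))).
  apply: le_integral_pointwise => x.
  have S0 : 0 <= \sum_(k <oo) (Y k x)%:E by apply: nneseries_ge0 => k _ _; rewrite lee_fin.
  have [hx1|hx1] := ltP (h x) 1%R.
    apply: (@le_trans _ _ 1); last by rewrite leeDl.
    by rewrite lee_fin exprn_ile1 // ltW.
  have ex : exists n, (h x < 2 ^+ n)%R.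
    exists (Num.trunc (h x)).+1; apply: lt_le_trans (truncnS_gt _) _.
    by rewrite -natrX ler_nat ltnW // ltn_expl.
  (* With [n + 1] the least exponent such that [h x < 2^(n+1)], the point lies in [A n], and that
     single layer already exceeds [h x ^ 2]. *)
  case: (ex_minnP ex) => -[|n] hn minn; first by move: hn; rewrite expr0 ltNge hx1.
  have An : x \in A n.
    by rewrite inE /A /= leNgt; apply/negP => /minn; rewrite ltnn.
  apply: (@le_trans _ _ (Y n x)%:E).
    rewrite /Y indicE An mulr1 lee_fin.
    have -> : (4 = 2 ^+ 2 :> R)%R by ring.
    by rewrite -exprM mulnC exprM ler_pXn2r ?nnegrE ?exprn_ge0 // ltW.
  apply: (@le_trans _ _ (\sum_(k <oo) (Y k x)%:E)); last by rewrite leeDr // lee_fin.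
  apply: (@le_trans _ _ (\sum_(0 <= k < n.+1) (Y k x)%:E)); last first.
    by apply: nneseries_lim_ge => k _ _; rewrite lee_fin.
  by rewrite big_nat_recr //= leeDr // sume_ge0 // => k _; rewrite lee_fin.
rewrite ge0_integralD //; last 2 first.
- by move=> x _; apply: nneseries_ge0 => k _ _; rewrite lee_fin.
- by apply: ge0_emeasurable_sum => k *; [rewrite lee_fin | exact/measurable_EFinP].
rewrite integral_cst_prob EFinD leeD2l //.
rewrite integral_nneseries //; last 2 first.
  by move=> k; exact/measurable_EFinP.
  by move=> k x _; rewrite lee_fin.
have Yint k : \int[P]_x (Y k x)%:E <= (4 * B * q ^+ k)%:E.
  under eq_integral do rewrite /Y EFinM.
  rewrite ge0_integralZl_EFin //; last first.
    by apply/measurable_EFinP; exact: measurable_indic.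
  rewrite integral_indic // setIT.
  have k0 : (0 < (2 : R) ^+ k)%R by rewrite exprn_gt0.
  apply: le_trans (lee_wpmul2l _ (hP _ k0)) _; first by rewrite lee_fin exprn_ge0.
  have E : ((2 ^+ k) `^ beta = (2 `^ beta) ^+ k :> R)%R.
    by rewrite -(powR_mulrn k (ltW p0)) -(powR_mulrn k (ler0n R 2)) -!powRrM mulrC.
  rewrite -EFinM lee_fin E /q expr_div_n exprS le_eqVlt; apply/orP; left; apply/eqP.
  by ring.
apply: lime_le.
  by apply: is_cvg_nneseries => k _ _; apply: integral_ge0 => x _; rewrite lee_fin.
apply: nearW => n; apply: (@le_trans _ _ (\sum_(0 <= k < n) (4 * B * q ^+ k)%:E)).
  by apply: lee_sum => k _.
rewrite sumEFin lee_fin -mulr_sumr ler_wpM2l ?mulr_ge0 ?(ltW B0) //.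
rewrite -[leRHS]div1r ler_pdivlMr ?subr_gt0 // mulrC big_mkord -opprB mulNr.
by rewrite -subrX1 opprB gerBl exprn_ge0 // ltW.
Qed.

End AlmostSure.

(** * Measurability of the iterates *)

Section Coordinates.
Context (R : realType).
Local Notation C := R[i].

(* Real coordinates of a complex matrix: [true] selects the real part. *)
Definition co m n (p : 'I_m * 'I_n * bool) (A : 'M[C]_(m, n)) : R :=
  if p.2 then complex.Re (A p.1.1 p.1.2) else complex.Im (A p.1.1 p.1.2).

Lemma ip_co m n (A B : 'M[C]_(m, n)) : ip A B = \sum_p co p A * co p B.
Proof.
rewrite ipE pair_bigA /= (eq_bigr (fun q : 'I_m * 'I_n => \sum_(b : bool)
   co (q, b) A * co (q, b) B)); last by move=> q _; rewrite big_bool /co /= addrC.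
by rewrite pair_bigA; apply: eq_bigr => -[].
Qed.

Lemma coD m n p (A B : 'M[C]_(m, n)) : co p (A + B) = co p A + co p B.
Proof. by rewrite /co !mxE ReD ImD; case: p.2. Qed.

Lemma coB m n p (A B : 'M[C]_(m, n)) : co p (A - B) = co p A - co p B.
Proof. by rewrite /co !mxE ReB ImB; case: p.2. Qed.

Lemma coZ m n p c (A : 'M[C]_(m, n)) : co p ((c%:C)%C *: A) = c * co p A.
Proof. by rewrite /co !mxE Re_rmul Im_rmul; case: p.2. Qed.

Lemma sqr_co_le m n p (A : 'M[C]_(m, n)) : co p A ^+ 2 <= ip A A.
Proof.
rewrite ip_co (bigD1 p) //= -expr2 lerDl sumr_ge0 // => q _.
by rewrite -expr2 sqr_ge0.
Qed.

Lemma norm_co_le1 m n p (A : 'M[C]_(m, n)) : ip A A <= 1 -> `|co p A| <= 1.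
Proof.
move=> A1; rewrite -(@ler_pXn2r _ 2) ?nnegrE // expr1n real_normK ?num_real //.
exact: le_trans (sqr_co_le p A) A1.
Qed.

(** Cauchy-Schwarz on the unit ball, from [0 <= |b A - B|^2] with [b = ip A B]. *)
Lemma sqr_ip_le m n (A B : 'M[C]_(m, n)) : ip A A <= 1 -> ip A B ^+ 2 <= ip B B.
Proof.
move=> A1; have := ip_ge0 (((ip A B)%:C)%C *: A - B).
rewrite !ip_lin (ipC B A); set b := ip A B => h.
have : b ^+ 2 * ip A A <= b ^+ 2 by rewrite ler_piMr // sqr_ge0.
by rewrite expr2; lra.
Qed.

End Coordinates.

Section ContinuousMeasurable.
Context (R : realType) (d : measure_display) (T : measurableType d).
Local Notation C := R[i].

(* The set [f > x] is the union of those cells of ever finer grids in the space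
   of values of [y] that it contains. *)
Lemma Fmeas_continuous (I : finType) (G : set (set T)) (y : I -> T -> R) (f : T -> R) :
  sigma_algebra setT G -> (forall i, Fmeas G (y i)) ->
  (forall w e, 0 < e -> exists2 dl, 0 < dl &
     forall w', (forall i, `|y i w - y i w'| < dl) -> `|f w - f w'| < e) ->
  Fmeas G f.
Proof.
move=> sG yG cf; apply/(Fmeas_measurable _ sG).
apply: (measurability _ (RGenOInfty.measurableE R)) => //.
move=> _ [_ [x ->] <-]; rewrite setTI.
pose cell (mz : nat * {ffun I -> int}) : set (g_sigma_algebraType G) :=
  \bigcap_(i in [set: I]) (y i @^-1` `[(mz.2 i)%:~R / mz.1.+1%:R,
     (mz.2 i + 1)%:~R / mz.1.+1%:R[%classic).
have mcell mz : measurable (cell mz).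
  apply: fin_bigcap_measurable => // i _.
  have /(Fmeas_measurable _ sG) my := yG i.
  by rewrite -[_ @^-1` _]setTI; apply: my => //; exact: measurable_itv.
pose D mz : set (g_sigma_algebraType G) :=
  if `[< cell mz `<=` f @^-1` `]x, +oo[%classic >] then cell mz else set0.
have -> : f @^-1` `]x, +oo[%classic = \bigcup_mz D mz.
  apply/seteqP; split => [w|w [mz _]]; last first.
    by rewrite /D; case: asboolP => // h; exact: h.
  rewrite /= in_itv /= andbT => xw.
  have [|dl dl0 hdl] := cf w (f w - x); first by rewrite subr_gt0.
  pose m := Num.trunc dl^-1.
  have mdl : m.+1%:R^-1 < dl.
    by rewrite invf_plt ?posrE // truncnS_gt.
  have m0 : 0 < m.+1%:R :> R by [].
  pose z : {ffun I -> int} := [ffun i => Num.floor (y i w * m.+1%:R)].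
  have incell : cell (m, z) w.
    move=> i _ /=; rewrite in_itv /= ffunE ler_pdivrMr // ltr_pdivlMr //.
    by rewrite floor_le_tmp floorD1_gt.
  have near_cell (u v a b : R) : u <= a < u + v -> u <= b < u + v -> `|b - a| < v.
    by move=> /andP[? ?] /andP[? ?]; rewrite ltr_norml; apply/andP; split; lra.
  exists (m, z) => //; rewrite /D; case: asboolP => //; case=> w' cw'.
  rewrite /= in_itv /= andbT.
  suff : `|f w - f w'| < f w - x by rewrite ltr_norml => /andP[_]; lra.
  apply: hdl => i; apply: lt_trans mdl.
  have := incell i Logic.I; have := cw' i Logic.I; rewrite /= !in_itv /= intrD mulr1z mulrDl mul1r.
  exact: near_cell.
apply: countable_bigcupT_measurable => [|mz]; first exact: countableP.
by rewrite /D; case: ifP.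
Qed.

Lemma mx_Fmeas_co (m n : nat) (G : set (set T)) (Y : T -> 'M[C]_(m, n)) :
  mx_Fmeas G Y <-> forall p, Fmeas G (fun w => co p (Y w)).
Proof.
split=> [h [[i j] b]|h i j]; first by have [h1 h2] := h i j; case: b.
by split; [exact: (h (i, j, true)) | exact: (h (i, j, false))].
Qed.

(** Comparing values at two outcomes makes [Z] a continuous function of the coordinates of [Y]
    without naming a projection map. *)
Lemma mx_Fmeas_nonexpansive (m n : nat) (G : set (set T)) (Y Z : T -> 'M[C]_(m, n)) :
  sigma_algebra setT G -> mx_Fmeas G Y ->
  (forall w w', ip (Z w - Z w') (Z w - Z w') <= ip (Y w - Y w') (Y w - Y w')) ->
  mx_Fmeas G Z.
Proof.
move=> sG /mx_Fmeas_co YG ZY; apply/mx_Fmeas_co => p.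
apply: (Fmeas_continuous sG YG) => w e e0.
(* The added 1 keeps [N] positive even for empty matrices and makes [(N - 1) (e / N)^2 < e^2]
   strict. *)
pose N : R := #|{: 'I_m * 'I_n * bool}|%:R + 1.
have N1 : 1 <= N by rewrite lerDr.
have N0 : 0 < N by exact: lt_le_trans N1.
exists (e / N) => [|w' hw']; first by rewrite divr_gt0.
rewrite -coB -(@ltr_pXn2r _ 2) ?nnegrE ?(ltW e0) // real_normK ?num_real //.
apply: le_lt_trans (sqr_co_le _ _) _; apply: le_lt_trans (ZY w w') _.
apply: (@le_lt_trans _ _ ((N - 1) * (e / N) ^+ 2)).
  rewrite /N addrK ip_co mulr_natl -sumr_const; apply: ler_sum => q _.
  rewrite coB -expr2 -(real_normK (num_real _)) ler_pXn2r ?nnegrE ?divr_ge0 ?(ltW e0) ?(ltW N0) //.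
  exact: ltW.
rewrite expr_div_n mulrA ltr_pdivrMr ?exprn_gt0 // mulrC ltr_pM2l ?exprn_gt0 //.
by rewrite expr2; nra.
Qed.

End ContinuousMeasurable.

(** * Regret of the noisy recursion *)

Lemma limn_esup_le0 (R : realType) (u b : nat -> R) : b @ \oo --> (0 : R) ->
  (forall n, u n <= b n) -> (limn_esup (fun n => (u n)%:E) <= 0)%E.
Proof.
move=> /cvgr0Pnorm_lt b0 ub; apply/lee_addgt0Pr => e e0; rewrite add0e.
have [N _ hN] := b0 _ e0.
apply: (@le_trans _ _ (ereal_sup ((fun n => (u n)%:E) @` [set n | (N <= n)%N]))).
  by apply: ereal_inf_lbound; exists [set n | (N <= n)%N] => //; exists N.
apply: ge_ereal_sup => _ [n /= Nn <-]; rewrite lee_fin.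
by apply: le_trans (ub n) _; apply: le_trans (ler_norm _) _; exact/ltW/hN.
Qed.

Lemma cvg_sum_fin (R : realType) (I : finType) (f : I -> nat -> R) :
  (forall i, f i @ \oo --> (0 : R)) -> (fun n => \sum_i f i n) @ \oo --> (0 : R).
Proof.
move=> f0; elim: (index_enum I) => [|i s IH].
  by under eq_fun do rewrite big_nil; exact: cvg_cst.
under eq_fun do rewrite big_cons.
suff : (fun n => f i n + \sum_(j <- s) f j n) @ \oo --> (0 + 0 : R) by rewrite addr0.
exact: cvgD.
Qed.

Section Regret.
Context (R : realType) (d : measure_display) (Omega : measurableType d).
Context (P : probability Omega R) (K M N : nat) (Pc Pmax : R).
Context (H : nat -> 'M[R[i]]_(K * N, K * M)) (V0 : R).
Context (F : nat -> set (set Omega)) (X Vhat : nat -> Omega -> 'M[R[i]]_(K * M)).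
Context (B beta gamma alpha : R).
Let V n w := Vgrad Pc Pmax (H n) (X n w).
Let xi n w := Vhat n w - V n w.
Let g := stepsize gamma alpha.
Hypotheses (Pc0 : 0 < Pc) (Pmax0 : 0 < Pmax).
Hypothesis V_le : forall n w, (0 < n)%N -> frob (V n w) <= V0.
Hypothesis filF : is_filtration F.
Hypothesis Vhat_Fmeas : forall n, (0 < n)%N -> mx_Fmeas (F n.+1) (Vhat n).
Hypothesis Vhat_condexp : forall n, (0 < n)%N -> mx_condexp P (F n) (Vhat n) (V n).
Hypotheses (B0 : 0 < B) (beta2 : 2 < beta).
Hypothesis tails : forall n z, (0 < n)%N -> 0 < z ->
  (P [set w | (z <= frob (xi n w))%R] <= ((B / z `^ beta)%R)%:E)%E.
Hypotheses (gamma0 : 0 < gamma) (alpha_gt : 2 / beta < alpha) (alpha1 : alpha < 1).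
Hypothesis X1 : exists A, @Xset R K M A /\ forall w, X 1%N w = A.
Hypothesis XS : forall n w, (0 < n)%N ->
  is_proj (@Xset R K M) (X n w + ((g n)%:C)%C *: Vhat n w) (X n.+1 w).

Let alpha0 : 0 < alpha.
Proof. by apply: lt_trans alpha_gt; rewrite divr_gt0 // (lt_trans _ beta2). Qed.

Let g_gt0 n : (0 < n)%N -> 0 < g n.
Proof. by move=> n0; rewrite divr_gt0 // powR_gt0 // ltr0n. Qed.

Let g_dec n : (0 < n)%N -> g n.+1 <= g n.
Proof.
move=> n0; rewrite ler_pM2l // lef_pV2 ?posrE ?powR_gt0 ?ltr0n //.
by apply: ge0_ler_powR; rewrite ?nnegrE ?ler_nat // ltW.
Qed.

Let sF n : sigma_algebra setT (F n). Proof. by case: filF. Qed.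
Let mF n : F n `<=` measurable. Proof. by case: filF => _ []. Qed.

Let F_mono m n : (m <= n)%N -> F m `<=` F n.
Proof.
elim: n => [|n IH]; first by rewrite leqn0 => /eqP ->.
rewrite leq_eqVlt => /predU1P[-> //|]; rewrite ltnS => /IH mn.
by apply: subset_trans mn _; case: filF => _ [_]; exact.
Qed.

Let X_Xset n w : (0 < n)%N -> Xset (X n w).
Proof.
case: n => [//|[_|n _]]; last by case: (XS w (ltn0Sn n)).
by have [A [XA ->]] := X1.
Qed.

(** The initial point is constant, and each step adds [Vhat n], known at time [n + 1], before
    projecting. *)
Let X_Fmeas n : (0 < n)%N -> mx_Fmeas (F n) (X n).
Proof.
elim: n => [//|[_ _|n IH _]].
  have [A [_ XA]] := X1; apply/mx_Fmeas_co => p.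
  by under eq_fun do rewrite XA; exact: Fmeas_cst.
pose Y w := X n.+1 w + ((g n.+1)%:C)%C *: Vhat n.+1 w.
apply: (@mx_Fmeas_nonexpansive _ _ _ _ _ _ Y) => //.
  apply/mx_Fmeas_co => p; under eq_fun do rewrite coD coZ.
  apply: FmeasD => //.
    apply: Fmeas_le (F_mono (leqnSn _)) _; exact: (mx_Fmeas_co _ _).1 (IH _) p.
  apply: FmeasM => //; first exact: Fmeas_cst.
  exact: (mx_Fmeas_co _ _).1 (Vhat_Fmeas _) p.
by move=> w w'; apply: proj_nonexpansive (XS _ _) (XS _ _).
Qed.

(** Read off from unbiasedness: a conditional expectation given [F n] is [F n]-measurable. *)
Let V_Fmeas n : (0 < n)%N -> mx_Fmeas (F n) (V n).
Proof. by move=> n0 i j; have [[h _] [h' _]] := Vhat_condexp n0 i j. Qed.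

Let co_xi_Fmeas n p : (0 < n)%N -> Fmeas (F n.+1) (fun w => co p (xi n w)).
Proof.
move=> n0; under eq_fun do rewrite coB.
apply: FmeasB => //; first exact: (mx_Fmeas_co _ _).1 (Vhat_Fmeas n0) p.
apply: Fmeas_le (F_mono (leqnSn _)) _; exact: (mx_Fmeas_co _ _).1 (V_Fmeas n0) p.
Qed.

Let co_xi_centered n p A : (0 < n)%N -> F n A ->
  (\int[P]_(w in A) (co p (xi n w))%:E = 0)%E.
Proof.
move=> n0 FA; have mA : measurable A by exact: mF FA.
have [h1 h2] := Vhat_condexp n0 p.1.1 p.1.2.
have [_ [i1 [i2 /(_ A FA) E]]] : condexp P (F n) (fun w => co p (Vhat n w)) (fun w => co p (V n w)).
  by rewrite /co; case: p.2.
have j1 : P.-integrable A (EFin \o (fun w => co p (Vhat n w))).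
  exact: integrableS measurableT mA (@subsetT _ _) i1.
have j2 : P.-integrable A (EFin \o (fun w => co p (V n w))).
  exact: integrableS measurableT mA (@subsetT _ _) i2.
under eq_integral do rewrite coB EFinB.
rewrite integralB //; rewrite [X in (X - _)%E]E subee //.
exact: integrable_fin_num.
Qed.

Let measurable_co_xi n p : (0 < n)%N -> measurable_fun setT (fun w => co p (xi n w)).
Proof. by move=> n0; exact: Fmeas_measurable_fun (@mF _) (co_xi_Fmeas p n0). Qed.

Let measurable_frob_xi n : (0 < n)%N -> measurable_fun setT (fun w => frob (xi n w)).
Proof.
move=> n0; apply: (@measurableT_comp _ _ _ _ _ _ (@Num.sqrt R)).
  by apply: continuous_measurable_fun; exact: sqrt_continuous.
under eq_fun do rewrite -/(ip _ _) ip_co.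
by apply: measurable_sum => p; apply: measurable_funM; exact: measurable_co_xi.
Qed.

Let xi_second_moment : exists2 C : R, 0 <= C & forall n, (0 < n)%N ->
  (\int[P]_w (frob (xi n w) ^+ 2)%:E <= C%:E)%E.
Proof.
have [C hC] := tail_second_moment P B0 beta2.
have h n : (0 < n)%N -> (\int[P]_w (frob (xi n w) ^+ 2)%:E <= C%:E)%E.
  move=> n0; apply: hC; first exact: measurable_frob_xi.
    by move=> w; exact: sqrtr_ge0.
  by move=> z z0; exact: tails.
exists C => //; rewrite -lee_fin; apply: le_trans (h 1%N isT).
by apply: integral_ge0 => w _; rewrite lee_fin sqr_ge0.
Qed.

Let L2_frob_xi n : (0 < n)%N -> L2 P (fun w => frob (xi n w)).
Proof.
move=> n0; have [C C0 hC] := xi_second_moment; split; first exact: measurable_frob_xi.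
apply/integrableP; split.
  by apply/measurable_EFinP; apply: measurable_funX; exact: measurable_frob_xi.
apply: le_lt_trans (ltry C); rewrite (le_trans _ (hC n n0)) // le_eqVlt; apply/orP; left.
by apply/eqP; apply: eq_integral => w _; rewrite gee0_abs // lee_fin sqr_ge0.
Qed.

Let L2_co_xi n p : (0 < n)%N -> L2 P (fun w => co p (xi n w)).
Proof.
move=> n0; apply: L2_le (L2_frob_xi n0); first exact: measurable_co_xi.
by move=> w; rewrite sqr_frob; exact: sqr_co_le.
Qed.

(** * Noise paired with predictable matrices of the unit ball *)

Section Predictable.
Variable U : nat -> Omega -> 'M[R[i]]_(K * M).
Hypothesis U_Fmeas : forall n, (0 < n)%N -> mx_Fmeas (F n) (U n).
Hypothesis U_le1 : forall n w, (0 < n)%N -> ip (U n w) (U n w) <= 1.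

Lemma ip_xi_Fmeas n : (0 < n)%N -> Fmeas (F n.+1) (fun w => ip (U n w) (xi n w)).
Proof.
move=> n0; under eq_fun do rewrite ip_co.
apply: Fmeas_sum => // p; apply: FmeasM => //; last exact: co_xi_Fmeas.
apply: Fmeas_le (F_mono (leqnSn _)) _; exact: (mx_Fmeas_co _ _).1 (U_Fmeas n0) p.
Qed.

Lemma ip_xi_L2 n : (0 < n)%N -> L2 P (fun w => ip (U n w) (xi n w)).
Proof.
move=> n0; apply: L2_le (L2_frob_xi n0).
  exact: Fmeas_measurable_fun (@mF _) (ip_xi_Fmeas n0).
by move=> w; rewrite sqr_frob; apply: sqr_ip_le; exact: U_le1.
Qed.

(** Coordinatewise [pull_out], with [f] times a coordinate of [U n] as the known factor. Taking
    [f = 1] gives mean zero; taking an earlier pairing gives orthogonality. *)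
Lemma ip_xi_orthogonal n f : (0 < n)%N -> Fmeas (F n) f -> L2 P f ->
  (\int[P]_w (f w * ip (U n w) (xi n w))%:E = 0)%E.
Proof.
move=> n0 fF Lf.
have mU p : Fmeas (F n) (fun w => co p (U n w)).
  exact: (mx_Fmeas_co _ _).1 (U_Fmeas n0) p.
have LfU p : L2 P (f \* (fun w => co p (U n w))).
  apply: (@L2M_bounded _ _ _ _ 1) => //.
    exact: Fmeas_measurable_fun (@mF _) (mU p).
  by move=> w; apply: norm_co_le1; exact: U_le1.
transitivity (\int[P]_w \sum_p ((f w * co p (U n w)) * co p (xi n w))%:E)%E.
  apply: eq_integral => w _; rewrite ip_co mulr_sumr sumEFin; congr EFin.
  by apply: eq_bigr => p _; rewrite mulrA.
rewrite integral_sum //; last first.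
  by move=> p; apply: (L2_integrableM (LfU p)); exact: L2_co_xi.
rewrite big1 // => p _.
apply: (@pull_out _ _ _ P (F n) _ (f \* (fun w => co p (U n w)))) => //.
- exact: L2_integrable (L2_co_xi p n0).
- by move=> A FA; exact: co_xi_centered.
- exact: FmeasM.
- by apply: (L2_integrableM (LfU p)); exact: L2_co_xi.
Qed.

Lemma ip_xi_mean0 n : (0 < n)%N -> (\int[P]_w (ip (U n w) (xi n w))%:E = 0)%E.
Proof.
move=> n0; have := ip_xi_orthogonal n0 (Fmeas_cst 1 (sF n)) (L2_cst P 1).
by under eq_integral do rewrite mul1r.
Qed.

Lemma ip_xi_slln : {ae P, forall w,
  (fun T => (\sum_(0 <= i < T) ip (U i.+1 w) (xi i.+1 w)) / T%:R) @ \oo --> (0 : R)}.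
Proof.
have [C C0 hC] := xi_second_moment.
apply: (@slln_orthogonal _ _ _ P (fun i w => ip (U i.+1 w) (xi i.+1 w)) C).
- by move=> i; exact: ip_xi_L2.
- move=> i; apply: le_trans (hC i.+1 isT); apply: le_integral_pointwise => w.
  by rewrite lee_fin sqr_frob; apply: sqr_ip_le; exact: U_le1.
- move=> i j ij; apply: ip_xi_orthogonal => //; last exact: ip_xi_L2.
  by apply: Fmeas_le (ip_xi_Fmeas _) => //; apply: F_mono; rewrite ltnS.
Qed.

End Predictable.

Let sqr_Vhat_le n w : (0 < n)%N ->
  ip (Vhat n w) (Vhat n w) <= 2 * V0 ^+ 2 + 2 * ip (xi n w) (xi n w).
Proof.
move=> n0; have hV : ip (V n w) (V n w) <= V0 ^+ 2.
  rewrite -sqr_frob ler_pXn2r ?nnegrE ?sqrtr_ge0 ?V_le //.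
  exact: le_trans (sqrtr_ge0 _) (V_le w n0).
have -> : Vhat n w = V n w + xi n w by rewrite addrC subrK.
move: (xi n w) => D; move: (V n w) hV => A hV.
by have := ip_ge0 (A - D); rewrite !ip_lin (ipC D A); lra.
Qed.

(** The comparator noise stays in a separate sum: it alone carries [Q], apart from the efficiencies
    on the left. *)
Let regret_term_le Q w T : Qset Pmax Q -> (0 < T)%N ->
  \sum_(1 <= n < T.+1) (EE Pc (H n) Q - EE Pc (H n) (Qmap Pc Pmax (X n w))) <=
  (g T)^-1 + \sum_(0 <= i < T) g i.+1 / 2 * ip (Vhat i.+1 w) (Vhat i.+1 w)
  + \sum_(0 <= i < T) ip (X i.+1 w) (xi i.+1 w)
  - \sum_(0 <= i < T) ip (Xmap Pc Pmax Q) (xi i.+1 w).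
Proof.
move=> QQ T0.
have XQ := Xmap_Xset Pc0 Pmax0 QQ.
have h := regret_bound g_gt0 g_dec (@X_Xset 1%N w isT) (fun n n0 => XS w n0) XQ T0.
rewrite !big_add1 /= in h *.
have h2 : \sum_(0 <= i < T) (EE Pc (H i.+1) Q - EE Pc (H i.+1) (Qmap Pc Pmax (X i.+1 w))) <=
    \sum_(0 <= i < T) ip (Xmap Pc Pmax Q - X i.+1 w) (V i.+1 w).
  by apply: ler_sum => i _; apply: EE_tangent => //; exact: X_Xset.
apply: le_trans h2 _.
have -> : \sum_(0 <= i < T) ip (Xmap Pc Pmax Q - X i.+1 w) (V i.+1 w) =
    \sum_(0 <= i < T) ip (Xmap Pc Pmax Q - X i.+1 w) (Vhat i.+1 w)
    + \sum_(0 <= i < T) ip (X i.+1 w) (xi i.+1 w)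
    - \sum_(0 <= i < T) ip (Xmap Pc Pmax Q) (xi i.+1 w).
  rewrite -big_split -sumrB; apply: eq_bigr => i _ /=.
  rewrite /xi; move: (V i.+1 w) (Vhat i.+1 w) (X i.+1 w) => A D E.
  by rewrite !ip_lin; ring.
by rewrite !lerD2r.
Qed.

Lemma no_regret_ae : {ae P, forall w, (limn_esup (fun T : nat =>
  ((Reg Pc Pmax H (fun n => Qmap Pc Pmax (X n w)) T / T%:R)%R)%:E) <= 0)%E}.
Proof.
have [C C0 hC] := xi_second_moment.
have hX := ip_xi_slln X_Fmeas (fun n w n0 => Xset_ip (X_Xset w n0)).
have hE : {ae P, forall w, forall p : 'I_(K * M) * 'I_(K * M) * bool,
    (fun T => (\sum_(0 <= i < T) co p (xi i.+1 w)) / T%:R) @ \oo --> (0 : R)}.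
  apply: filter_forall => p.
  apply: (@slln_orthogonal _ _ _ P (fun i w => co p (xi i.+1 w)) C).
  - by move=> i; exact: L2_co_xi.
  - move=> i; apply: le_trans (hC i.+1 isT); apply: le_integral_pointwise => w.
    by rewrite lee_fin sqr_frob; exact: sqr_co_le.
  - move=> i j ij.
    apply: (@pull_out _ _ _ P (F j.+1) _ (fun w => co p (xi i.+1 w))) => //.
    + exact: L2_integrable (L2_co_xi p _).
    + by move=> A FA; exact: co_xi_centered.
    + by apply: Fmeas_le (co_xi_Fmeas p _) => //; apply: F_mono; rewrite ltnS.
    + by apply: L2_integrableM; exact: L2_co_xi.
have hG : {ae P, forall w, cvgn (series (fun i =>
    g i.+1 * ip (xi i.+1 w) (xi i.+1 w) / i.+1%:R))}.
  apply: (@ae_cvgn_series _ _ _ P _ (fun i => g i.+1 / i.+1%:R * C)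
    (gamma * (1 + alpha^-1) * C)).
  - move=> i; apply: measurable_funM => //; apply: measurable_funM => //.
    under eq_fun do rewrite ip_co.
    by apply: measurable_sum => p; apply: measurable_funM; exact: measurable_co_xi.
  - by move=> i w; rewrite divr_ge0 // mulr_ge0 ?ip_ge0 // ltW // g_gt0.
  - move=> i; rewrite EFinM; apply: le_trans (_ : ((g i.+1 / i.+1%:R)%:E *
        \int[P]_w (frob (xi i.+1 w) ^+ 2)%:E <= _)%E); last first.
      by rewrite lee_wpmul2l ?hC // lee_fin divr_ge0 // ltW // g_gt0.
    rewrite -ge0_integralZl_EFin //.
    + apply: le_integral_pointwise => w; rewrite sqr_frob -EFinM lee_fin.
      by rewrite mulrAC.
    + by move=> w _; rewrite lee_fin sqr_ge0.
    + by apply/measurable_EFinP; apply: measurable_funX; exact: measurable_frob_xi.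
    + by rewrite divr_ge0 // ltW // g_gt0.
  - move=> n; rewrite -mulr_suml ler_wpM2r //.
    apply: le_trans (ler_wpM2l (ltW gamma0) (sum_stepsize_le n alpha0)).
    by rewrite mulr_sumr; apply: ler_sum => i _; rewrite /g /stepsize div1r !mulrA.
apply: filterS3 hX hE hG => w hX hE hG.
(* A majorant free of [Q], so that it bounds the supremum defining the regret. *)
pose b T := (g T)^-1 / T%:R + V0 ^+ 2 * ((\sum_(0 <= i < T) g i.+1) / T%:R)
  + (\sum_(0 <= i < T) g i.+1 * ip (xi i.+1 w) (xi i.+1 w)) / T%:R
  + (\sum_(0 <= i < T) ip (X i.+1 w) (xi i.+1 w)) / T%:R
  + \sum_p `|(\sum_(0 <= i < T) co p (xi i.+1 w)) / T%:R|.
apply: (@limn_esup_le0 _ _ b).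
  have -> : (0 : R) = 0 + V0 ^+ 2 * 0 + 0 + 0 + 0 by ring.
  apply: cvgD; last first.
    apply: cvg_sum_fin => p; have := cvg_norm (hE p).
    by rewrite normr0; apply.
  apply: cvgD => //; apply: cvgD; last exact: kronecker.
  apply: cvgD; first exact: cvg_inv_stepsize.
  apply: cvgM; first exact: cvg_cst.
  by apply: kronecker; exact: cvgn_series_stepsize.
(* At [T = 0] both sides are 0, division by zero being zero. *)
case=> [|T].
  rewrite invr0 mulr0 /b !invr0 !mulr0 !addr0 big1 // => p _.
  by rewrite mulr0 normr0.
have T0 : 0 < T.+1%:R :> R by [].
rewrite ler_pdivrMr //; apply: ge_sup.
  by exists (\sum_(1 <= n < T.+2) (EE Pc (H n) 0 - EE Pc (H n) (Qmap Pc Pmax (X n w)))), 0 => //;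
    apply: cov_set0; exact: ltW.
move=> _ [Q QQ <-]; apply: le_trans (regret_term_le w QQ (ltn0Sn T)) _.
rewrite /b !mulrDl !divfK ?gt_eqF // -[V0 ^+ 2 * _ * _]mulrA divfK ?gt_eqF //.
have h1 : \sum_(0 <= i < T.+1) g i.+1 / 2 * ip (Vhat i.+1 w) (Vhat i.+1 w) <=
    V0 ^+ 2 * (\sum_(0 <= i < T.+1) g i.+1) +
    \sum_(0 <= i < T.+1) g i.+1 * ip (xi i.+1 w) (xi i.+1 w).
  rewrite mulr_sumr -big_split; apply: ler_sum => i _ /=.
  have gi := g_gt0 (ltn0Sn i).
  have := ler_wpM2l (ltW gi) (sqr_Vhat_le w (ltn0Sn i)); lra.
have h2 : - \sum_(0 <= i < T.+1) ip (Xmap Pc Pmax Q) (xi i.+1 w) <=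
    (\sum_p `|(\sum_(0 <= i < T.+1) co p (xi i.+1 w)) / T.+1%:R|) * T.+1%:R.
  apply: le_trans (ler_norm _) _; rewrite normrN.
  under eq_bigr do rewrite ip_co.
  rewrite exchange_big /= mulr_suml; apply: le_trans (ler_norm_sum _ _ _) _.
  apply: ler_sum => p _; rewrite -mulr_sumr normrM normf_div (gtr0_norm T0) divfK ?gt_eqF //.
  rewrite ler_piMl // norm_co_le1 //; apply: Xset_ip.
  exact: Xmap_Xset.
lra.
Qed.

(** The regret at [w] is a supremum of [A Q - a w], in which [Q] and [w] are separated. This lets
    the supremum be handled outside the integral. *)
Lemma expected_regret (T : nat) : (0 < T)%N ->
  (\int[P]_w ((Reg Pc Pmax H (fun n => Qmap Pc Pmax (X n w)) T)%R)%:E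
       <= (((stepsize gamma alpha T)^-1)%R)%:E
          + ((1 / 2)%R)%:E * ereal_sup [set \int[P]_w (((frob (Vhat n w)) ^+ 2)%R)%:E | n in [set n : nat | (0 < n)%N]]
            * ((\sum_(1 <= n < T.+1) stepsize gamma alpha n)%R)%:E)%E.
Proof.
move=> T0; have [C C0 hC] := xi_second_moment.
set S := ereal_sup _.
have L2V n : (0 < n)%N -> L2 P (fun w => frob (Vhat n w)).
  move=> n0; have [_ ixi] := L2_frob_xi n0.
  have mV : measurable_fun setT (fun w => frob (Vhat n w)).
    apply: (@measurableT_comp _ _ _ _ _ _ (@Num.sqrt R)).
      by apply: continuous_measurable_fun; exact: sqrt_continuous.
    under eq_fun do rewrite -/(ip _ _) ip_co.
    apply: measurable_sum => p; apply: measurable_funM;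
      exact: Fmeas_measurable_fun (@mF _) ((mx_Fmeas_co _ _).1 (Vhat_Fmeas n0) p).
  split => //.
  have i2 := integrableZl measurableT 2 ixi.
  have := integrableD measurableT (finite_measure_integrable_cst P (2 * V0 ^+ 2) measurableT) i2.
  apply: le_integrable => //.
    by apply/measurable_EFinP; exact: measurable_funX.
  move=> w _; rewrite /= lee_fin !sqr_frob (ger0_norm (ip_ge0 _)).
  by apply: le_trans (ler_norm _); exact: sqr_Vhat_le.
have Sle : (S <= (2 * V0 ^+ 2 + 2 * C)%:E)%E.
  apply: ge_ereal_sup => _ [n /= n0 <-].
  have [_ ixi] := L2_frob_xi n0.
  apply: (@le_trans _ _ (\int[P]_w ((cst (2 * V0 ^+ 2)%:E w +
      2%:E * (frob (xi n w) ^+ 2)%:E)))%E).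
    apply: le_integral_pointwise => w; rewrite -EFinM -EFinD lee_fin !sqr_frob.
    exact: sqr_Vhat_le.
  rewrite integralD //; last 2 first.
    exact: (finite_measure_integrable_cst P (2 * V0 ^+ 2) measurableT).
    exact: integrableZl.
  rewrite integralZl // integral_cst_prob [leRHS]EFinD leeD2l //.
  by rewrite EFinM lee_wpmul2l ?hC.
have S0 : (0 <= S)%E.
  apply: le_trans (_ : (\int[P]_w (frob (Vhat 1%N w) ^+ 2)%:E <= S)%E).
    by apply: integral_ge0 => w _; rewrite lee_fin sqr_ge0.
  by apply: ereal_sup_ubound; exists 1%N.
(* Finiteness of the supremum of second moments turns the extended-real right-hand side into real
   arithmetic. *)
have Sfin : S \is a fin_num by rewrite ge0_fin_numE //; apply: le_lt_trans Sle (ltry _).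
have IV n : (0 < n)%N -> (\int[P]_w (frob (Vhat n w) ^+ 2)%:E <= S)%E.
  by move=> n0; apply: ereal_sup_ubound; exists n.
apply/lee_addgt0Pr => e e0.
pose A Q := \sum_(1 <= n < T.+1) EE Pc (H n) Q.
pose a w := \sum_(1 <= n < T.+1) EE Pc (H n) (Qmap Pc Pmax (X n w)).
have Aa Q w : \sum_(1 <= n < T.+1) (EE Pc (H n) Q - EE Pc (H n) (Qmap Pc Pmax (X n w))) =
  A Q - a w by rewrite sumrB.
have zQ : @Qset R K M Pmax 0 by apply: cov_set0; exact: ltW.
(* The upper bound on [A] comes from the tangent inequality at one arbitrary outcome [point]: each
   increment is at most [<D, V>] with [|D|^2 <= 2] and [|V|^2 <= V0^2]. *)
have supA : has_sup [set A Q | Q in @Qset R K M Pmax].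
  split; first by exists (A 0), 0.
  exists (a point + \sum_(1 <= n < T.+1) (2 + V0 ^+ 2) / 2) => _ [Q QQ <-].
  rewrite -lerBlDl -Aa !big_nat; apply: ler_sum => n /andP[n0 _].
  have XQ := Xmap_Xset Pc0 Pmax0 QQ.
  apply: le_trans (EE_tangent Pc0 Pmax0 _ QQ (X_Xset point n0)) _.
  have hV : ip (V n point) (V n point) <= V0 ^+ 2.
    rewrite -sqr_frob ler_pXn2r ?nnegrE ?sqrtr_ge0 ?V_le //.
    exact: le_trans (sqrtr_ge0 _) (V_le point n0).
  have half (p q r v : R) : r <= v -> p <= 2 -> 2 * q <= p + r -> q <= (2 + v) / 2.
    by lra.
  exact: half hV (Xset_dist XQ (X_Xset point n0)) (ip_amgm _ _).
(* The channels are deterministic, hence so is the near-optimal comparator [Q]. *)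
have [_ [Q QQ <-] AQ] := sup_adherent e0 supA.
have XQ := Xmap_Xset Pc0 Pmax0 QQ.
pose c := (g T)^-1 + e.
apply: (@le_trans _ _ (\int[P]_w (c%:E +
    (\sum_(0 <= i < T) ((g i.+1 / 2)%:E * (frob (Vhat i.+1 w) ^+ 2)%:E) +
     \sum_(0 <= i < T) ((ip (X i.+1 w) (xi i.+1 w))%:E -
        (ip (Xmap Pc Pmax Q) (xi i.+1 w))%:E))))%E).
  apply: le_integral_pointwise => w.
  rewrite [X in (_ <= _ + (X + _))%E](_ : _ =
     (\sum_(0 <= i < T) g i.+1 / 2 * ip (Vhat i.+1 w) (Vhat i.+1 w))%:E)%E; last first.
    by rewrite -sumEFin; apply: eq_bigr => i _; rewrite sqr_frob.
  rewrite [X in (_ <= _ + (_ + X))%E](_ : _ =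
     (\sum_(0 <= i < T) ip (X i.+1 w) (xi i.+1 w)
      - \sum_(0 <= i < T) ip (Xmap Pc Pmax Q) (xi i.+1 w))%:E)%E; last first.
    by rewrite -sumrB -sumEFin; apply: eq_bigr => i _; rewrite EFinB.
  rewrite -!EFinD lee_fin; apply: (@le_trans _ _ (A Q + e - a w)).
    apply: ge_sup; first by exists (A 0 - a w), 0 => //; rewrite Aa.
    move=> _ [Q' QQ' <-]; rewrite Aa lerD2r.
    apply: le_trans (_ : A Q' <= sup [set A Q | Q in @Qset R K M Pmax]) _.
      by apply: ub_le_sup; [case: supA | exists Q'].
    by rewrite -lerBlDr ltW.
  have := regret_term_le w QQ T0; rewrite Aa /c; lra.
have iVe i : P.-integrable setT (fun w => (g i.+1 / 2)%:E * (frob (Vhat i.+1 w) ^+ 2)%:E)%E.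
  by apply: integrableZl => //; exact: (L2V i.+1 isT).2.
have cX n : (0 < n)%N -> mx_Fmeas (F n) (fun w : Omega => Xmap Pc Pmax Q).
  by move=> _; apply/mx_Fmeas_co => p; exact: Fmeas_cst.
have bX n (w : Omega) : (0 < n)%N -> ip (Xmap Pc Pmax Q) (Xmap Pc Pmax Q) <= 1.
  by move=> _; exact: Xset_ip.
have bX' n (w : Omega) : (0 < n)%N -> ip (X n w) (X n w) <= 1.
  by move=> n0; apply: Xset_ip; exact: X_Xset.
have iX i : P.-integrable setT (fun w => (ip (X i.+1 w) (xi i.+1 w))%:E).
  exact: L2_integrable (@ip_xi_L2 X X_Fmeas bX' i.+1 isT).
have iQ i : P.-integrable setT (fun w => (ip (Xmap Pc Pmax Q) (xi i.+1 w))%:E).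
  exact: L2_integrable (@ip_xi_L2 (fun _ _ => Xmap Pc Pmax Q) cX bX i.+1 isT).
have iD i : P.-integrable setT (fun w => (ip (X i.+1 w) (xi i.+1 w))%:E -
        (ip (Xmap Pc Pmax Q) (xi i.+1 w))%:E)%E by exact: integrableB.
rewrite integralD //; last 2 first.
  exact: (finite_measure_integrable_cst P c measurableT).
  by apply: integrableD => //; exact: integrable_sum.
rewrite integralD //; [|exact: integrable_sum..].
rewrite !integral_sum //.
(* Both noise pairings have mean zero: the iterate is predictable and the comparator is constant. *)
rewrite [X in (_ + (_ + X))%E]big1 ?adde0; last first.
  move=> i _; rewrite integralB //.
  rewrite (@ip_xi_mean0 X X_Fmeas bX' i.+1 isT).
  by rewrite (@ip_xi_mean0 (fun _ _ => Xmap Pc Pmax Q) cX bX i.+1 isT) subee.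
rewrite integral_cst_prob /c EFinD -addeA -[leRHS]addeA leeD2l // addeC leeD2r //.
rewrite -(fineK Sfin) -!EFinM.
apply: (@le_trans _ _ (\sum_(0 <= i < T) ((g i.+1 / 2) * fine S)%:E)%E).
  apply: lee_sum => i _; rewrite integralZl //; last exact: (L2V i.+1 isT).2.
  rewrite [leRHS]EFinM fineK // lee_wpmul2l ?IV // lee_fin divr_ge0 // ltW // g_gt0 //.
rewrite sumEFin lee_fin big_add1 /= -mulr_suml -mulr_suml le_eqVlt; apply/orP; left.
by apply/eqP; rewrite /g; ring.
Qed.

End Regret.

Theorem theorem2 (R : realType) (d : measure_display) (Omega : measurableType d)
  (P : probability Omega R) (K M N : nat) (Pc Pmax : R)
  (H : nat -> 'M[R[i]]_(K * N, K * M)) (V0 : R)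
  (F : nat -> set (set Omega))
  (X Vhat : nat -> Omega -> 'M[R[i]]_(K * M))
  (B beta gamma alpha : R) :
  (0 < K)%N -> (0 < M)%N -> (0 < N)%N -> 0 < Pc -> 0 < Pmax ->
  (* block-diagonal, uniformly bounded effective channels *)
  (forall n, (0 < n)%N -> blockdiag (H n)) ->
  (exists Hb : R, forall n, (0 < n)%N -> frob (H n) <= Hb) ->
  (* bounded true gradients V(n) *)
  (forall n w, (0 < n)%N -> frob (Vgrad Pc Pmax (H n) (X n w)) <= V0) ->
  (* history filtration; Vhat(n) is known once X(n+1) is chosen *)
  is_filtration F ->
  (forall n, (0 < n)%N -> mx_Fmeas (F n.+1) (Vhat n)) ->
  (* Hermitian estimates *)
  (forall n w, (0 < n)%N -> is_hermitian (Vhat n w)) ->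
  (* (H1) unbiasedness: E[Vhat(n) | F_n] = V(n) *)
  (forall n, (0 < n)%N ->
     mx_condexp P (F n) (Vhat n) (fun w => Vgrad Pc Pmax (H n) (X n w))) ->
  (* (H2) tame error tails *)
  0 < B -> 2 < beta ->
  (forall n z, (0 < n)%N -> 0 < z ->
     (P [set w | (z <= frob (Vhat n w - Vgrad Pc Pmax (H n) (X n w)))%R]
       <= ((B / z `^ beta)%R)%:E)%E) ->
  (* step sizes *)
  0 < gamma -> 2 / beta < alpha -> alpha < 1 ->
  (* deterministic initial point in Xset and the recursion *)
  (exists X1, @Xset R K M X1 /\ forall w, X 1%N w = X1) ->
  (forall n w, (0 < n)%N ->
     is_proj (@Xset R K M) (X n w + ((stepsize gamma alpha n)%:C)%C *: Vhat n w) (X n.+1 w)) ->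
  (* conclusions *)
  {ae P, forall w, (limn_esup (fun T : nat =>
      ((Reg Pc Pmax H (fun n => Qmap Pc Pmax (X n w)) T / T%:R)%R)%:E) <= 0)%E} /\
  (forall T : nat, (0 < T)%N ->
     (\int[P]_w ((Reg Pc Pmax H (fun n => Qmap Pc Pmax (X n w)) T)%R)%:E
       <= (((stepsize gamma alpha T)^-1)%R)%:E
          + ((1 / 2)%R)%:E * ereal_sup [set \int[P]_w (((frob (Vhat n w)) ^+ 2)%R)%:E | n in [set n : nat | (0 < n)%N]]
            * ((\sum_(1 <= n < T.+1) stepsize gamma alpha n)%R)%:E)%E).
Proof.
move=> _ _ _ Pc0 Pmax0 _ _ V_le filF VF _ Vc B0 b2 tails g0 ag a1 X1 XS.
split; first exact: (@no_regret_ae _ _ _ P K M N Pc Pmax H V0 F X Vhat B beta gamma alpha).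
exact: (@expected_regret _ _ _ P K M N Pc Pmax H V0 F X Vhat B beta gamma alpha).
Qed.
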